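(* Let $(\alpha_k)_{k\in\mathbb{Z}}$ be real numbers, $a_k:=\alpha_k^2$, and consider the random Fourier series $$\Psi(t)=\frac{\alpha_0Y^0}{2}+\sum_{k=1}^\infty\big(\alpha_kY^k\sin(kt)+\alpha_{-k}Y^{-k}\cos(kt)\big),\qquad t\in[0,2\pi],$$ where $(Y^k)_{k\in\mathbb{Z}}$ are real-valued, centered random variables with $\mathbb{E}Y^kY^l=\delta_{k,l}$ for all $k,l\in\mathbb{Z}$. Let $\rho\ge1$ and assume that each of the two sequences $(c_k)_{k\ge0}=(a_k)_{k\ge0}$ and $(c_k)_{k\ge0}=(a_{-k})_{k\ge0}$ satisfies $$\Delta^2(k^2c_k)\le0\ \text{ for all }k\ge0,\qquad \lim_{k\to\infty}\big(k^3|\Delta^2c_k|+k^2|\Delta c_k|\big)=0,\qquad c_k=O\big(k^{-(1+1/\rho)}\big)\ \text{ as }k\to\infty,$$ and that $(c_k)_{k\ge1}$ is nonincreasing. Then the covariance $R_\Psi(s,t)=\mathbb{E}\Psi(s)\Psi(t)$ of $\Psi$ has finite H\''older controlled $(1,\rho)$-variation, and there is a constant $C>0$ such that $$V_{1,\rho}(R_\Psi;[s,t]\times[u,v])\le C|t-s|^{1/(2\rho)}|v-u|^{1/(2\rho)}\qquad\text{for all }[s,t]\times[u,v]\subseteq[0,2\pi]^2 .$$ The constant $C$ depends only on $\rho$ and $C_1$, where $C_1\ge\sup_{k\in\mathbb{Z}}a_k|k|^{1+1/\rho}$.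
   Context: For a sequence $(c_k)_{k\ge0}$, $\Delta c_k:=c_{k+1}-c_k$ and $\Delta^2=\Delta\circ\Delta$. Rectangular increments: $R\binom{s,t}{u,v}=R(s,u)-R(s,v)-R(t,u)+R(t,v)$. $\mathcal{D}([s,t])$ is the set of all (finite) dissections of $[s,t]$. For $\gamma,\rho\ge1$, $$V_{\gamma,\rho}(R;[s,t]\times[u,v])=\sup_{(t_i)\in\mathcal{D}([s,t]),\,(t'_j)\in\mathcal{D}([u,v])}\Big(\sum_{t'_j}\Big(\sum_{t_i}\Big|R\tbinom{t_i,t_{i+1}}{t'_j,t'_{j+1}}\Big|^{\gamma}\Big)^{\rho/\gamma}\Big)^{1/\rho}.$$ ''Finite H\''older controlled $(1,\rho)$-variation'' means $V_{1,\rho}(R;[s,t]^2)\le C|t-s|^{1/\rho}$ for all $[s,t]$ (a special case of the displayed estimate). Under the assumptions $\sum_k a_k<\infty$, so for fixed $t$ the series converges in $L^2$. *)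

(* Defs.v *)
From HB Require Import structures.
From mathcomp Require Import all_boot all_order all_algebra.
From mathcomp Require Import all_classical all_reals all_analysis.

Set Implicit Arguments.
Unset Strict Implicit.
Unset Printing Implicit Defensive.

Import Order.TTheory GRing.Theory Num.Theory.
Import numFieldNormedType.Exports.

Local Open Scope classical_set_scope.
Local Open Scope ring_scope.

Definition rect_incr (R : realType) (f : R -> R -> R) (s t u v : R) : R :=
  f s u - f s v - f t u + f t v.

(* For p with itv_partition s t p, the dissection is s :: p, whose i-th interval
   is [nth s (s :: p) i, nth s p i], i < size p. *)
Definition mixed_variation_sum (R : realType) (gamma rho : R)
    (f : R -> R -> R) (s u : R) (p q : seq R) : R :=
  (\sum_(j < size q)
     (\sum_(i < size p)
        `|rect_incr f (nth s (s :: p) i) (nth s p i)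
                      (nth u (u :: q) j) (nth u q j)| `^ gamma)
     `^ (rho / gamma)) `^ rho^-1.

Definition mixed_variation (R : realType) (gamma rho : R)
    (f : R -> R -> R) (s t u v : R) : \bar R :=
  ereal_sup [set x | exists p q : seq R,
    [/\ itv_partition s t p, itv_partition u v q &
        x = (mixed_variation_sum gamma rho f s u p q)%:E]].

Definition finite_holder_controlled_variation (R : realType) (rho a b : R)
    (f : R -> R -> R) : Prop :=
  exists C : R, forall s t : R, a <= s -> s <= t -> t <= b ->
    (mixed_variation 1 rho f s t s t <= (C * `|t - s| `^ rho^-1)%:E)%E.

(* [telescope c] is the forward difference: telescope c k = c k.+1 - c k. *)
Definition fourier_coef_cond (R : realType) (rho : R) (c : R^nat) : Prop :=
  [/\ forall k, telescope (telescope (fun n => n%:R ^+ 2 * c n)) k <= 0,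
      (fun k => k%:R ^+ 3 * `|telescope (telescope c) k|
                + k%:R ^+ 2 * `|telescope c k|) @ \oo --> (0 : R),
      c =O_\oo (fun k => k%:R `^ (- (1 + rho^-1))) &
      nonincreasing_seq (fun k => c k.+1)].

Section random_fourier_series.
Context (R : realType) (d : measure_display) (T : measurableType d)
        (P : probability T R).
Implicit Types (alpha : int -> R) (Y : int -> {RV P >-> R})
         (Psi : R -> {RV P >-> R}).

Definition fourier_partial_sum alpha Y (n : nat) (t : R) : T -> R := 
  fun w : T =>
  alpha 0 * Y 0 w / 2 +
  \sum_(1 <= k < n.+1) (alpha k%:Z * Y k%:Z w * sin (k%:R * t)
                        + alpha (- k%:Z) * Y (- k%:Z) w * cos (k%:R * t)).

(* For each t in [0, 2 pi], Psi t is (a version of) the L^2(P) limit of the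
   partial sums. *)
Definition is_random_fourier_series alpha Y Psi : Prop :=
  forall t, 0 <= t <= 2 * pi ->
    ('N[P]_2%:E[EFin \o (fourier_partial_sum alpha Y n t \- Psi t)%R])%E
      @[n --> \oo] --> 0%E.

(* [fine] loses nothing for s, t in [0, 2 pi] when Psi is a random Fourier series
   with orthonormal Y: then Psi s and Psi t are square-integrable. *)
Definition fourier_covariance Psi (s t : R) : R :=
  fine ('E_P[(Psi s \* Psi t)%R])%E.

End random_fourier_series.

(* Main.v *)
(** With [f_c x = sum_(k >= 1) c_k cos (k x)], the covariance is, up to a
constant, half the sum of [f_a (s - t)], [- f_a (s + t)], [f_b (s - t)] and
[f_b (s + t)], where [a_k = alpha_k ^ 2] and [b_k = alpha_(-k) ^ 2].

Concavity of [k ^ 2 c_k] makes [f_c] convex on [[0, 2 pi]]: summing twice by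
parts, the second derivative of the [n]-th Cesaro mean of the series at [x] is at
least [- n c_n / (1 - cos x)] up to a constant factor, and [n c_n] tends to 0.
The bound on [c_k] gives [f_c 0 - f_c x <= M x ^ (1/rho)], and convexity
together with the symmetry [f_c (2 pi - x) = f_c x] propagates this modulus to
the whole interval.

For the kernel [f (s - t)] with such an [f], rectangles off the diagonal have
increments of constant sign, so their absolute values telescope; an interval of
[t] inside the range of [s] contributes at most its length to the power [1/rho],
because [f] is monotone on both halves of [[0, 2 pi]].  Hence the [rho]-th power
of the mixed variation is at most a constant times the smaller side length, which
is below the geometric mean of the two.  Reversing time reduces [f (s + t)] to
[f (s - t)]. *)

Require Import Defs.
From HB Require Import structures.
From mathcomp Require Import all_boot all_order all_algebra.
From mathcomp Require Import all_classical all_reals all_analysis.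
From mathcomp Require Import measurable_realfun ring lra.

Set Implicit Arguments.
Unset Strict Implicit.
Unset Printing Implicit Defensive.

Import Order.TTheory GRing.Theory Num.Theory.
Import numFieldNormedType.Exports.

Local Open Scope classical_set_scope.
Local Open Scope ring_scope.

(** * Rectangular increments of convex stationary kernels *)

Section sums_of_powers.
Variables (R : realType) (rho : R).
Hypothesis rho_ge1 : 1 <= rho.
Implicit Types (a b : R).

Lemma powR_superadditive a b : 0 <= a -> 0 <= b ->
  a `^ rho + b `^ rho <= (a + b) `^ rho.
Proof.
move=> a0 b0; have rho0 : 0 < rho by move: rho_ge1; lra.
rewrite -(mulr_powRB1 a0 rho0) -(mulr_powRB1 b0 rho0).
rewrite -(mulr_powRB1 (addr_ge0 a0 b0) rho0) mulrDl.
by apply: lerD; apply: ler_wpM2l => //; apply: ge0_ler_powR;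
  rewrite ?nnegrE ?lerDl ?lerDr ?subr_ge0 ?addr_ge0.
Qed.

Lemma sum_powR_le_powR_sum (a : R^nat) n : (forall i, 0 <= a i) ->
  \sum_(i < n) a i `^ rho <= (\sum_(i < n) a i) `^ rho.
Proof.
move=> a0; elim: n => [|n IH]; first by rewrite !big_ord0 powR0//; move: rho_ge1; lra.
rewrite !big_ord_recr/= (le_trans _ (powR_superadditive _ _))//.
  by rewrite lerD2r.
by apply: sumr_ge0.
Qed.

Lemma powRD_le a b : 0 <= a -> 0 <= b ->
  (a + b) `^ rho <= 2 `^ rho * (a `^ rho + b `^ rho).
Proof.
have rho0 : 0 <= rho by move: rho_ge1; lra.
wlog ab : a b / a <= b => [H a0 b0|a0 b0].
  have [/H|/ltW ba] := leP a b; first exact.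
  by rewrite addrC [X in _ * X]addrC; apply: H.
apply: (@le_trans _ _ ((2 * b) `^ rho)).
  by apply: ge0_ler_powR; rewrite ?nnegrE ?addr_ge0 ?mulr_ge0// mulrDl mul1r lerD2r.
by rewrite powRM// ler_wpM2l ?powR_ge0// lerDr powR_ge0.
Qed.

Lemma sum_powRD_le (a b c : R^nat) n :
    (forall i, 0 <= a i) -> (forall i, 0 <= b i) -> (forall i, 0 <= c i <= a i + b i) ->
  \sum_(i < n) c i `^ rho <=
  2 `^ rho * (\sum_(i < n) a i `^ rho + \sum_(i < n) b i `^ rho).
Proof.
move=> a0 b0 cab; rewrite -big_split/= mulr_sumr; apply: ler_sum => i _.
apply: le_trans (powRD_le _ _) => //; have /andP[c0 cle] := cab i.
by apply: ge0_ler_powR; rewrite ?nnegrE ?addr_ge0//; move: rho_ge1; lra.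
Qed.

End sums_of_powers.

Section increments.
Variable R : realType.
Implicit Types (f g : R -> R) (F : R -> R -> R) (x y : R^nat).

Lemma min_max_split (V : zmodType) (g : R -> V) (u c : R) :
  g u = g (Num.min u c) + g (Num.max u c) - g c.
Proof.
have [uc|uc] := leP u c; first by rewrite addrK.
by rewrite addrC addrA addNr add0r.
Qed.

Lemma incr_min_le (a b c : R) : a <= b -> Num.min b c - Num.min a c <= b - a.
Proof. by move=> ab; case: (leP a c); case: (leP b c) => ? ?; lra. Qed.

Lemma incr_max_le (a b c : R) : a <= b -> Num.max b c - Num.max a c <= b - a.
Proof. by move=> ab; case: (leP a c); case: (leP b c) => ? ?; lra. Qed.

Lemma nondecreasing_min x (c : R) :
  nondecreasing_seq x -> nondecreasing_seq (fun i => Num.min (x i) c).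
Proof. by move=> xnd m n mn; rewrite le_min !ge_min lexx orbT andbT xnd. Qed.

Lemma nondecreasing_max x (c : R) :
  nondecreasing_seq x -> nondecreasing_seq (fun i => Num.max (x i) c).
Proof. by move=> xnd m n mn; rewrite ge_max !le_max lexx orbT andbT xnd. Qed.

Lemma sum_incr_monotone g x n :
    (forall i, (i < n)%N -> g (x i) <= g (x i.+1)) ->
  \sum_(i < n) `|g (x i.+1) - g (x i)| = g (x n) - g (x 0%N).
Proof.
move=> gx; rewrite -[RHS](telescope_sumr (fun i => g (x i)))// big_mkord.
by apply: eq_bigr => i _; rewrite ger0_norm// subr_ge0 gx.
Qed.

Lemma sum_incr_antitone g x n :
    (forall i, (i < n)%N -> g (x i.+1) <= g (x i)) ->
  \sum_(i < n) `|g (x i.+1) - g (x i)| = g (x 0%N) - g (x n).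
Proof.
move=> gx; have H := @sum_incr_monotone (fun z => - g z) x n.
rewrite -[RHS]opprB opprD -H => [|i /gx]; last by rewrite lerN2.
by apply: eq_bigr => i _; rewrite -opprD normrN.
Qed.

Lemma sum_incr_split g x n (c : R) :
  \sum_(i < n) `|g (x i.+1) - g (x i)| <=
  \sum_(i < n) `|g (Num.min (x i.+1) c) - g (Num.min (x i) c)| +
  \sum_(i < n) `|g (Num.max (x i.+1) c) - g (Num.max (x i) c)|.
Proof.
rewrite -big_split/=; apply: ler_sum => i _; apply: le_trans (ler_normD _ _).
rewrite le_eqVlt; apply/orP; left; apply/eqP; congr `|_|.
by rewrite (min_max_split g (x i.+1) c) (min_max_split g (x i) c); ring.
Qed.

Lemma rect_incr_split F (s t u v c : R) :
  rect_incr F s t u v = rect_incr F s t (Num.min u c) (Num.min v c)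
                      + rect_incr F s t (Num.max u c) (Num.max v c).
Proof.
rewrite /rect_incr.
rewrite (min_max_split (F s) u c) (min_max_split (F s) v c).
by rewrite (min_max_split (F t) u c) (min_max_split (F t) v c); ring.
Qed.

Lemma telescope_rect_incr1 F x n (u v : R) :
  \sum_(i < n) rect_incr F (x i) (x i.+1) u v = rect_incr F (x 0%N) (x n) u v.
Proof.
elim: n => [|n IH]; first by rewrite big_ord0 /rect_incr; ring.
by rewrite big_ord_recr/= IH /rect_incr; ring.
Qed.

Lemma telescope_rect_incr2 F y m (s t : R) :
  \sum_(j < m) rect_incr F s t (y j) (y j.+1) = rect_incr F s t (y 0%N) (y m).
Proof.
elim: m => [|m IH]; first by rewrite big_ord0 /rect_incr; ring.
by rewrite big_ord_recr/= IH /rect_incr; ring.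
Qed.

End increments.

Section convex_stationary_kernel.
Variables (R : realType) (rho M : R) (f : R -> R).
Hypothesis rho_ge1 : 1 <= rho.
Hypothesis f_even : forall x, f (- x) = f x.
Hypothesis f_sym : forall x, f (2 * pi - x) = f x.
Hypothesis f_convex : forall p q h : R, 0 <= p -> p <= q -> 0 <= h -> q + h <= 2 * pi ->
  f (p + h) - f p <= f (q + h) - f q.
Hypothesis f_modulus0 : forall x : R, 0 <= x -> x <= 2 * pi ->
  f 0 - f x <= M * x `^ rho^-1.

Let F (s t : R) := f (s - t).

Let rho_gt0 : 0 < rho. Proof. by move: rho_ge1; lra. Qed.

Let le_powRV (a b : R) : 0 <= a -> a <= b -> a `^ rho^-1 <= b `^ rho^-1.
Proof.
move=> a0 ab; apply: ge0_ler_powR; rewrite ?nnegrE ?invr_ge0 ?(ltW rho_gt0)//.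
exact: le_trans ab.
Qed.

Lemma modulus_ge0 : 0 <= M.
Proof.
have pi0 : 0 < pi :> R := pi_gt0 R.
have := @f_modulus0 (2 * pi) _ _.
rewrite -(f_sym (2 * pi)) subrr subrr => /(_ _ _) H.
have {H} : 0 <= M * (2 * pi) `^ rho^-1 by apply: H; lra.
by rewrite pmulr_lge0// powR_gt0// mulr_gt0.
Qed.

Lemma convex_modulus (x y : R) : 0 <= x -> x <= y -> y <= 2 * pi ->
  `|f y - f x| <= M * (y - x) `^ rho^-1.
Proof.
move=> x0 xy y2.
have H1 : f (0 + (y - x)) - f 0 <= f (x + (y - x)) - f x by apply: f_convex; lra.
have H2 : f (0 + (y - x)) - f 0 <= f ((2 * pi - y) + (y - x)) - f (2 * pi - y).
  by apply: f_convex; lra.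
have e1 : x + (y - x) = y by ring.
have e2 : 2 * pi - y + (y - x) = 2 * pi - x by ring.
move: H1 H2; rewrite e1 e2 add0r !f_sym => H1 H2.
have := @f_modulus0 (y - x) _ _; rewrite ler_norml => /(_ _ _)H.
have {}H : f 0 - f (y - x) <= M * (y - x) `^ rho^-1 by apply: H; lra.
by apply/andP; split; lra.
Qed.

Lemma convex_modulus_norm (x y : R) : `|x| <= 2 * pi -> `|y| <= 2 * pi ->
  `|f y - f x| <= M * `|y - x| `^ rho^-1.
Proof.
have f_norm z : f `|z| = f z by case: (ger0P z).
wlog xy : x y / `|x| <= `|y| => [H x2 y2|x2 y2].
  have [|/ltW] := leP `|x| `|y|; first by move/H; exact.
  by move/H; rewrite distrC (distrC x); exact.
rewrite -(f_norm x) -(f_norm y).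
apply: (le_trans (convex_modulus _ _ _)) => //.
apply: ler_wpM2l; first exact: modulus_ge0.
by apply: le_powRV; rewrite ?subr_ge0// lerB_dist.
Qed.

Lemma convex_antitone (x y : R) : 0 <= x -> x <= y -> y <= pi -> f y <= f x.
Proof.
move=> x0 xy ypi.
have := @f_convex x (2 * pi - y) (y - x) x0.
have -> : x + (y - x) = y by ring.
have -> : 2 * pi - y + (y - x) = 2 * pi - x by ring.
by rewrite !f_sym => H; have {H} : f y - f x <= f x - f y by [apply: H; lra]; lra.
Qed.

Lemma convex_monotone (x y : R) : pi <= x -> x <= y -> y <= 2 * pi -> f x <= f y.
Proof.
by move=> pix xy y2; rewrite -(f_sym x) -(f_sym y); apply: convex_antitone; lra.
Qed.

Lemma convex_variation x n : nondecreasing_seq x -> 0 <= x 0%N -> x n <= 2 * pi ->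
  \sum_(i < n) `|f (x i.+1) - f (x i)| <= 2 * M * (x n - x 0%N) `^ rho^-1.
Proof.
move=> xnd x0 xn; have x0n : x 0%N <= x n by exact: xnd.
have pi0 : 0 < pi :> R := pi_gt0 R.
have M0 := modulus_ge0.
apply: (le_trans (sum_incr_split f x n pi)).
rewrite (@sum_incr_antitone _ f (fun i => Num.min (x i) pi)); last first.
  move=> i lt_in; have := xnd 0%N i isT; have := xnd _ _ (leqnSn i) => /= xi xi'.
  by apply: convex_antitone; rewrite ?le_min ?ge_min ?lexx ?orbT//; lra.
rewrite (@sum_incr_monotone _ f (fun i => Num.max (x i) pi)); last first.
  move=> i lt_in; have := xnd _ _ lt_in; have := xnd _ _ (leqnSn i) => /= xi xi'.
  by apply: convex_monotone; rewrite ?le_max ?ge_max ?lexx ?orbT//; lra.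
have -> : 2 * M * (x n - x 0%N) `^ rho^-1 =
    M * (x n - x 0%N) `^ rho^-1 + M * (x n - x 0%N) `^ rho^-1 by ring.
have cmp a b : 0 <= a -> a <= b -> b <= 2 * pi -> b - a <= x n - x 0%N ->
    `|f b - f a| <= M * (x n - x 0%N) `^ rho^-1.
  move=> a0 ab b2 H; apply: (le_trans (convex_modulus _ _ _)) => //.
  by apply: ler_wpM2l => //; apply: le_powRV; lra.
apply: lerD.
  apply: (le_trans (ler_norm _)); rewrite distrC; apply: cmp.
  - by rewrite le_min x0; lra.
  - by rewrite le_min !ge_min lexx orbT andbT x0n.
  - by rewrite ge_min xn.
  - exact: incr_min_le.
apply: (le_trans (ler_norm _)); apply: cmp.
- by rewrite le_max x0.
- by rewrite ge_max !le_max lexx orbT andbT x0n.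
- by rewrite ge_max xn; lra.
- exact: incr_max_le.
Qed.

Lemma rect_incr_swap s t u v : rect_incr F s t u v = rect_incr F u v s t.
Proof.
rewrite /rect_incr /F -(f_even (s - u)) -(f_even (s - v)) -(f_even (t - u)).
rewrite -(f_even (t - v)) !opprB; ring.
Qed.

Lemma rect_incr_offdiagonal_le0 (s t u v : R) : 0 <= s -> s <= t -> 0 <= u -> u <= v ->
    t <= 2 * pi -> v <= 2 * pi -> t <= u \/ v <= s ->
  rect_incr F s t u v <= 0.
Proof.
move=> s0 st u0 uv t2 v2; wlog tu : s t u v s0 st u0 uv t2 v2 / t <= u => [H [tu|vs]|_].
- by apply: H => //; left.
- by rewrite rect_incr_swap; apply: H => //; left.
have := @f_convex (u - t) (u - s) (v - u); rewrite /rect_incr /F.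
have -> : u - t + (v - u) = v - t by ring.
have -> : u - s + (v - u) = v - s by ring.
rewrite -(f_even (s - u)) -(f_even (s - v)) -(f_even (t - u)) -(f_even (t - v)).
rewrite !opprB => H.
by have {H} : f (v - t) - f (u - t) <= f (v - s) - f (u - s) by [apply: H; lra]; lra.
Qed.

Lemma rect_incr_le2 (s t u v : R) : 0 <= s -> s <= t -> 0 <= u -> u <= v ->
    t <= 2 * pi -> v <= 2 * pi ->
  `|rect_incr F s t u v| <= 2 * M * (v - u) `^ rho^-1.
Proof.
move=> s0 st u0 uv t2 v2.
have -> : rect_incr F s t u v = (f (s - u) - f (s - v)) - (f (t - u) - f (t - v)).
  by rewrite /rect_incr /F; ring.
have bnd z : 0 <= z <= 2 * pi -> `|f (z - u) - f (z - v)| <= M * (v - u) `^ rho^-1.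
  move=> zpi; have -> : v - u = `|(z - u) - (z - v)| by rewrite ger0_norm; lra.
  by apply: convex_modulus_norm; rewrite ler_norml; lra.
apply: (le_trans (ler_normB _ _)).
have -> : 2 * M * (v - u) `^ rho^-1 =
    M * (v - u) `^ rho^-1 + M * (v - u) `^ rho^-1 by ring.
by apply: lerD; apply: bnd; lra.
Qed.

Lemma rect_incr_le1 (s t u v : R) : 0 <= s -> s <= t -> 0 <= u -> u <= v ->
    t <= 2 * pi -> v <= 2 * pi ->
  `|rect_incr F s t u v| <= 2 * M * (t - s) `^ rho^-1.
Proof. by move=> *; rewrite rect_incr_swap; apply: rect_incr_le2. Qed.

Lemma sum_rect_incr_offdiagonal x n u v : nondecreasing_seq x ->
    0 <= x 0%N -> x n <= 2 * pi -> 0 <= u -> u <= v -> v <= 2 * pi ->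
    x n <= u \/ v <= x 0%N ->
  \sum_(i < n) `|rect_incr F (x i) (x i.+1) u v| = - rect_incr F (x 0%N) (x n) u v.
Proof.
move=> xnd x0 xn u0 uv v2 off.
rewrite -telescope_rect_incr1 -sumrN; apply: eq_bigr => i _.
have h0 := xnd 0%N i isT; have h1 := xnd _ _ (leqnSn i); have h2 := xnd _ _ (ltn_ord i).
rewrite /= in h0 h1 h2.
by rewrite ler0_norm//; apply: rect_incr_offdiagonal_le0; lra.
Qed.

Lemma sum_rect_incr_split (x : R^nat) n (u v c : R) :
  \sum_(i < n) `|rect_incr F (x i) (x i.+1) u v| <=
  \sum_(i < n) `|rect_incr F (Num.min (x i) c) (Num.min (x i.+1) c) u v| +
  \sum_(i < n) `|rect_incr F (Num.max (x i) c) (Num.max (x i.+1) c) u v|.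
Proof.
rewrite -big_split/=; apply: ler_sum => i _; apply: le_trans (ler_normD _ _).
rewrite !(rect_incr_swap _ _ u v) -rect_incr_split.
by rewrite lexx.
Qed.

Lemma sum_rect_incr_inside x n u v : nondecreasing_seq x ->
    0 <= x 0%N -> x n <= 2 * pi -> 0 <= u -> u <= v -> v <= 2 * pi ->
  \sum_(i < n) `|rect_incr F (x i) (x i.+1) u v| <= 8 * M * (v - u) `^ rho^-1.
Proof.
move=> xnd x0 xn u0 uv v2.
apply: (le_trans (sum_rect_incr_split x n u v u)).
have -> : 8 * M * (v - u) `^ rho^-1 = 2 * M * (v - u) `^ rho^-1 +
    (4 * M * (v - u) `^ rho^-1 + 2 * M * (v - u) `^ rho^-1) by ring.
apply: lerD.
  rewrite (@sum_rect_incr_offdiagonal (fun i => Num.min (x i) u))//; last first.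
  - by left; rewrite ge_min lexx orbT.
  - by rewrite ge_min xn.
  - by rewrite le_min x0.
  - exact: nondecreasing_min.
  apply: (le_trans (ler_norm _)); rewrite normrN; apply: rect_incr_le2 => //.
  - by rewrite le_min x0.
  - by apply: nondecreasing_min.
  - by rewrite ge_min xn.
pose x' i := Num.max (x i) u.
have x'nd : nondecreasing_seq x' by apply: nondecreasing_max.
have x'0 i : u <= x' i by rewrite le_max lexx orbT.
have x'n : x' n <= 2 * pi by rewrite ge_max xn; lra.
apply: (le_trans (sum_rect_incr_split x' n u v v)); apply: lerD; last first.
  rewrite (@sum_rect_incr_offdiagonal (fun i => Num.max (x' i) v))//; last first.
  - by right; rewrite le_max lexx orbT.
  - by rewrite ge_max x'n.
  - by rewrite le_max (le_trans u0).
  - exact: nondecreasing_max.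
  apply: (le_trans (ler_norm _)); rewrite normrN; apply: rect_incr_le2 => //.
  - by rewrite le_max (le_trans u0).
  - by apply: nondecreasing_max.
  - by rewrite ge_max x'n.
pose z i := Num.min (x' i) v.
have znd : nondecreasing_seq z by apply: nondecreasing_min.
have zu i : u <= z i by rewrite le_min x'0.
have zv i : z i <= v by rewrite ge_min lexx orbT.
apply: (@le_trans _ _ (\sum_(i < n) `|f (z i.+1 - u) - f (z i - u)| +
  \sum_(i < n) `|f (2 * pi - (v - z i.+1)) - f (2 * pi - (v - z i))|)).
  rewrite -big_split/=; apply: ler_sum => i _.
  rewrite !f_sym -(f_even (v - z i)) -(f_even (v - z i.+1)) !opprB.
  rewrite -(normrN (f (z i.+1 - u) - _)); apply: le_trans (ler_normD _ _).
  by rewrite le_eqVlt; apply/orP; left; apply/eqP; congr `|_|; rewrite /rect_incr /F /z; ring.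
have M0 := modulus_ge0.
have z0n : z 0%N <= z n by apply: znd.
have zu0 := zu 0%N; have zv0 := zv 0%N; have zun := zu n; have zvn := zv n.
have -> : 4 * M * (v - u) `^ rho^-1 =
    2 * M * (v - u) `^ rho^-1 + 2 * M * (v - u) `^ rho^-1 by ring.
have le_pow w : 0 <= w -> w <= v - u -> 2 * M * w `^ rho^-1 <= 2 * M * (v - u) `^ rho^-1.
  move=> w0 wuv; apply: ler_wpM2l; first by rewrite mulr_ge0.
  by apply: le_powRV.
apply: lerD.
  apply: (le_trans (@convex_variation (fun i => z i - u) _ _ _ _)); try lra.
    by move=> i j ij; rewrite lerD2r znd.
  by apply: le_pow; lra.
apply: (le_trans (@convex_variation (fun i => 2 * pi - (v - z i)) _ _ _ _)); try lra.
  by move=> i j ij; rewrite lerD2l lerN2 lerD2l lerN2 znd.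
by apply: le_pow; lra.
Qed.

Let S (x : R^nat) n (u v : R) := \sum_(i < n) `|rect_incr F (x i) (x i.+1) u v|.

Let S_ge0 x n u v : 0 <= S x n u v. Proof. exact: sumr_ge0. Qed.

Let S_split (x : R^nat) n (u v c : R) :
  0 <= S x n u v <= S x n (Num.min u c) (Num.min v c) + S x n (Num.max u c) (Num.max v c).
Proof.
rewrite S_ge0 -big_split/=; apply: ler_sum => i _; apply: le_trans (ler_normD _ _).
by rewrite -rect_incr_split.
Qed.

Let powR_modulus (K w : R) : 0 <= K -> 0 <= w -> (K * w `^ rho^-1) `^ rho = K `^ rho * w.
Proof.
move=> K0 w0; rewrite powRM ?powR_ge0// -powRrM mulVf ?powRr1//.
by rewrite gt_eqF.
Qed.

Let le_powR (a b : R) : 0 <= a -> a <= b -> a `^ rho <= b `^ rho.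
Proof.
move=> a0 ab; apply: ge0_ler_powR; rewrite ?nnegrE ?(ltW rho_gt0)//.
exact: le_trans ab.
Qed.

Lemma sum_powR_offdiagonal x y n m : nondecreasing_seq x -> nondecreasing_seq y ->
    0 <= x 0%N -> x n <= 2 * pi -> 0 <= y 0%N -> y m <= 2 * pi ->
    x n <= y 0%N \/ y m <= x 0%N ->
  \sum_(j < m) S x n (y j) (y j.+1) `^ rho <=
  (2 * M) `^ rho * Num.min (x n - x 0%N) (y m - y 0%N).
Proof.
move=> xnd ynd x0 xn y0 ym off.
have M0 := modulus_ge0.
have xx : x 0%N <= x n by exact: xnd.
have yy : y 0%N <= y m by exact: ynd.
apply: (le_trans (@sum_powR_le_powR_sum _ _ rho_ge1 (fun j => S x n (y j) (y j.+1)) m _)) => //.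
have -> : \sum_(i < m) S x n (y i) (y i.+1) = - rect_incr F (x 0%N) (x n) (y 0%N) (y m).
  rewrite -telescope_rect_incr2 -sumrN; apply: eq_bigr => j _.
  have h0 := ynd 0%N j isT; have h1 := ynd _ _ (leqnSn j); have h2 := ynd _ _ (ltn_ord j).
  rewrite /= in h0 h1 h2.
  by apply: sum_rect_incr_offdiagonal => //; lra.
have neg : 0 <= - rect_incr F (x 0%N) (x n) (y 0%N) (y m).
  rewrite oppr_ge0; apply: rect_incr_offdiagonal_le0 => //.
apply: (@le_trans _ _ ((2 * M * Num.min (x n - x 0%N) (y m - y 0%N) `^ rho^-1) `^ rho)).
  apply: le_powR => //; apply: (le_trans (ler_norm _)); rewrite normrN.
  by case: (leP (x n - x 0%N) _) => _; [apply: rect_incr_le1|apply: rect_incr_le2].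
by rewrite powR_modulus// ?mulr_ge0// le_min; apply/andP; split; lra.
Qed.

Lemma sum_powR_inside x y n m : nondecreasing_seq x -> nondecreasing_seq y ->
    0 <= x 0%N -> x n <= 2 * pi -> 0 <= y 0%N -> y m <= 2 * pi ->
  \sum_(j < m) S x n (y j) (y j.+1) `^ rho <= (8 * M) `^ rho * (y m - y 0%N).
Proof.
move=> xnd ynd x0 xn y0 ym; have M0 := modulus_ge0.
rewrite -(@telescope_sumr _ 0%N m)// big_mkord mulr_sumr; apply: ler_sum => j _.
have h0 := ynd 0%N j isT; have h1 := ynd _ _ (leqnSn j); have h2 := ynd _ _ (ltn_ord j).
rewrite /= in h0 h1 h2.
rewrite -powR_modulus ?mulr_ge0//; last lra.
by apply: le_powR => //; apply: sum_rect_incr_inside => //; lra.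
Qed.

(* The part of [y] in [x 0, x n] is controlled interval by interval; on the two
   remaining parts the rectangular increments have constant sign and telescope. *)
Lemma sum_powR_stationary x y n m : nondecreasing_seq x -> nondecreasing_seq y ->
    0 <= x 0%N -> x n <= 2 * pi -> 0 <= y 0%N -> y m <= 2 * pi ->
  \sum_(j < m) (\sum_(i < n) `|rect_incr F (x i) (x i.+1) (y j) (y j.+1)|) `^ rho <=
  2 `^ rho * ((2 * M) `^ rho + 2 `^ rho * ((8 * M) `^ rho + (2 * M) `^ rho)) *
  Num.min (x n - x 0%N) (y m - y 0%N).
Proof.
move=> xnd ynd x0 xn y0 ym.
have xx : x 0%N <= x n by exact: xnd.
have yy : y 0%N <= y m by exact: ynd.
have x0' : 0 <= x n by exact: le_trans xx.
have powR2 : 0 <= 2 `^ rho :> R by exact: powR_ge0.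
set D := Num.min _ _.
pose ya j := Num.min (y j) (x 0%N); pose yb j := Num.max (y j) (x 0%N).
pose yc j := Num.min (yb j) (x n); pose yd j := Num.max (yb j) (x n).
have split1 := @sum_powRD_le _ rho rho_ge1 (fun j => S x n (ya j) (ya j.+1))
  (fun j => S x n (yb j) (yb j.+1)) (fun j => S x n (y j) (y j.+1)) m
  (fun=> S_ge0 _ _ _ _) (fun=> S_ge0 _ _ _ _) (fun j => S_split _ _ _ _ _).
apply: (le_trans split1); rewrite -mulrA; apply: ler_wpM2l => //.
rewrite mulrDl; apply: lerD.
  apply: (le_trans (@sum_powR_offdiagonal x ya n m _ _ _ _ _ _ _)) => //.
  - exact: nondecreasing_min.
  - by rewrite le_min y0.
  - by rewrite ge_min ym.
  - by right; rewrite ge_min lexx orbT.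
  apply: ler_wpM2l; first exact: powR_ge0.
  by rewrite le_min !ge_min lexx (incr_min_le _ yy) orbT.
have split2 := @sum_powRD_le _ rho rho_ge1 (fun j => S x n (yc j) (yc j.+1))
  (fun j => S x n (yd j) (yd j.+1)) (fun j => S x n (yb j) (yb j.+1)) m
  (fun=> S_ge0 _ _ _ _) (fun=> S_ge0 _ _ _ _) (fun j => S_split _ _ _ _ _).
apply: (le_trans split2); rewrite -mulrA; apply: ler_wpM2l => //.
have ybnd : nondecreasing_seq yb by apply: nondecreasing_max.
rewrite mulrDl; apply: lerD.
  apply: (le_trans (@sum_powR_inside x yc n m _ _ _ _ _ _)) => //.
  - exact: nondecreasing_min.
  - by rewrite le_min x0' le_max x0 orbT.
  - by rewrite ge_min xn orbT.
  apply: ler_wpM2l; first exact: powR_ge0.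
  rewrite le_min (le_trans (incr_min_le _ (ybnd _ _ (leq0n m))) (incr_max_le _ yy)) andbT.
  by apply: lerB; rewrite ?ge_min ?le_min ?le_max lexx ?orbT ?xx.
apply: (le_trans (@sum_powR_offdiagonal x yd n m _ _ _ _ _ _ _)) => //.
- exact: nondecreasing_max.
- by rewrite le_max x0' orbT.
- by rewrite ge_max xn andbT ge_max ym; lra.
- by left; rewrite le_max lexx orbT.
apply: ler_wpM2l; first exact: powR_ge0.
rewrite le_min !ge_min lexx/=.
by rewrite (le_trans (incr_max_le _ (ybnd _ _ (leq0n m))) (incr_max_le _ yy)) orbT.
Qed.

End convex_stationary_kernel.

Section reflection.
Variables (R : realType) (rho M : R) (f : R -> R).
Hypothesis rho_ge1 : 1 <= rho.
Hypothesis f_even : forall x, f (- x) = f x.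
Hypothesis f_sym : forall x, f (2 * pi - x) = f x.
Hypothesis f_convex : forall p q h : R, 0 <= p -> p <= q -> 0 <= h -> q + h <= 2 * pi ->
  f (p + h) - f p <= f (q + h) - f q.
Hypothesis f_modulus0 : forall x : R, 0 <= x -> x <= 2 * pi ->
  f 0 - f x <= M * x `^ rho^-1.

(* [f (s + t) = f (s - (2 pi - t))], so reversing [y] reduces to the stationary
   kernel. *)
Lemma sum_powR_antistationary (x y : R^nat) n m :
    nondecreasing_seq x -> nondecreasing_seq y ->
    0 <= x 0%N -> x n <= 2 * pi -> 0 <= y 0%N -> y m <= 2 * pi ->
  \sum_(j < m) (\sum_(i < n)
     `|rect_incr (fun s t => f (s + t)) (x i) (x i.+1) (y j) (y j.+1)|) `^ rho <=
  2 `^ rho * ((2 * M) `^ rho + 2 `^ rho * ((8 * M) `^ rho + (2 * M) `^ rho)) *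
  Num.min (x n - x 0%N) (y m - y 0%N).
Proof.
move=> xnd ynd x0 xn y0 ym.
have yy : y 0%N <= y m by exact: ynd.
pose y' j := 2 * pi - y (m - j)%N.
have y'nd : nondecreasing_seq y'.
  by move=> i j ij; rewrite lerD2l lerN2; apply: ynd; exact: leq_sub2l.
have := @sum_powR_stationary _ _ _ _ rho_ge1 f_even f_sym f_convex f_modulus0
  x y' n m xnd y'nd x0 xn.
rewrite /y' subn0 subnn => /(_ _ _)H.
have -> : y m - y 0%N = 2 * pi - y 0%N - (2 * pi - y m) by ring.
apply: le_trans (H _ _); try lra.
rewrite (reindex_inj rev_ord_inj)/= le_eqVlt; apply/orP; left; apply/eqP.
apply: eq_bigr => j _; congr (_ `^ _); apply: eq_bigr => i _.
have jm : (j < m)%N by [].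
rewrite -[`|rect_incr (fun s t => f (s - t)) _ _ _ _|]normrN; congr `|_|.
rewrite /rect_incr -subSn// subSS.
have E a b : f (a - (2 * pi - b)) = f (a + b).
  by rewrite -f_even -f_sym; congr f; ring.
by rewrite !E; ring.
Qed.

End reflection.

Lemma mixed_variation_le (R : realType) (rho B s t u v : R) (F : R -> R -> R) :
    1 <= rho ->
    (forall (x y : R^nat) n m, nondecreasing_seq x -> nondecreasing_seq y ->
      x 0%N = s -> x n = t -> y 0%N = u -> y m = v ->
      \sum_(j < m) (\sum_(i < n)
        `|rect_incr F (x i) (x i.+1) (y j) (y j.+1)|) `^ rho <= B) ->
  (mixed_variation 1 rho F s t u v <= (B `^ rho^-1)%:E)%E.
Proof.
move=> rho1 H; have rho0 : 0 <= rho by lra.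
have partE (a b : R) p : itv_partition a b p ->
    let x i := nth b (a :: p) i in
    [/\ nondecreasing_seq x, x 0%N = a & x (size p) = b].
  case=> p1 /eqP p2 /=.
  have pb : nth b (a :: p) (size p) = b.
    by rewrite -[size p]/((size (a :: p)).-1) nth_last.
  split => //.
  have lastE i : (size p <= i)%N -> nth b (a :: p) i = b.
    by rewrite leq_eqVlt => /predU1P[<-//|ip]; rewrite nth_default.
  apply/nondecreasing_seqP => i; have [ip|ip] := ltnP i (size p).
    by move/(pathP b): p1 => /(_ _ ip)/ltW.
  by rewrite !lastE// ltnW.
apply: ub_ereal_sup => _ [p [q [sp uq ->]]].
rewrite lee_fin /mixed_variation_sum.
have [xnd x0 xn] := partE _ _ _ sp; have [ynd y0 ym] := partE _ _ _ uq.
apply: ge0_ler_powR; rewrite ?nnegrE ?invr_ge0//.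
- by apply: sumr_ge0 => j _; exact: powR_ge0.
- apply: le_trans (H _ _ _ _ xnd ynd x0 xn y0 ym).
  by apply: sumr_ge0 => j _; exact: powR_ge0.
apply: le_trans (H _ _ _ _ xnd ynd x0 xn y0 ym).
rewrite le_eqVlt; apply/orP; left; apply/eqP.
apply: eq_bigr => j _; rewrite divr1; congr (_ `^ _).
apply: eq_bigr => i _; rewrite powRr1//.
rewrite !(set_nth_default t s)//= ?ltnS ?(ltnW (ltn_ord _))//.
by rewrite !(set_nth_default v u)//= ?ltnS ?(ltnW (ltn_ord _))//.
Qed.

(** * Modulus of continuity of cosine series *)

Section power_sums.
Variables (R : realType) (theta : R).
Hypothesis theta_gt0 : 0 < theta.
Hypothesis theta_le1 : theta <= 1.

Lemma powR_telescope_bound (a : R) : 1 <= a ->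
  a `^ (- (1 + theta)) <= 4 / theta * (a `^ (- theta) - (a + 1) `^ (- theta)).
Proof.
move=> a1; have a0 : 0 < a by lra.
have t0 := theta_gt0; have t1 := theta_le1.
pose q := (1 + a^-1) `^ theta.
have ai : 0 < a^-1 by rewrite invr_gt0.
have ai1 : a^-1 <= 1 by rewrite invf_le1.
have q2 : q <= 2.
  by apply: (@le_trans _ _ (1 + a^-1)); [apply: ler1_powR; lra|lra].
have bi : 0 < (a + 1)^-1 by rewrite invr_gt0; lra.
have q1 : 1 + theta * (a + 1)^-1 <= q.
  apply: (@le_trans _ _ (1 + theta * ln (1 + a^-1))).
    rewrite lerD2l; apply: ler_wpM2l; first lra.
    have -> : 1 + a^-1 = (1 - (a + 1)^-1)^-1 by field; lra.
    rewrite lnV; last first.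
      by rewrite posrE subr_gt0 invf_lt1; lra.
    rewrite lerNr; apply: le_ln1Dx.
    by rewrite ltrN2 invf_lt1; lra.
  by rewrite /q /powR gt_eqF ?expR_ge1Dx//; lra.
have q0 : 0 < q by apply: lt_le_trans q1; rewrite addr_gt0// mulr_gt0.
have -> : (a + 1) `^ (- theta) = a `^ (- theta) / q.
  have -> : a + 1 = a * (1 + a^-1) by field; lra.
  by rewrite powRM; [rewrite [X in _ * X]powRN|lra|lra].
have -> : a `^ (- (1 + theta)) = a `^ (- theta) / a.
  rewrite opprD powRD; last by rewrite (gt_eqF a0) implybT.
  by rewrite powR_inv1 1?mulrC// ltW.
have P0 : 0 < a `^ (- theta) by rewrite powR_gt0.
have -> : 4 / theta * (a `^ (- theta) - a `^ (- theta) / q) =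
  a `^ (- theta) * (4 / theta * (1 - q^-1)) by ring.
rewrite ler_pM2l//.
have : theta / (4 * a) <= 1 - q^-1.
  have -> : 1 - q^-1 = (q - 1) * q^-1 by field; rewrite gt_eqF.
  have qi : 2^-1 <= q^-1 by rewrite lef_pV2 ?posrE.
  have h : theta / (2 * a) <= q - 1.
    apply: (@le_trans _ _ (theta * (a + 1)^-1)); last lra.
    by apply: ler_wpM2l; [lra|rewrite lef_pV2 ?posrE; lra].
  apply: (@le_trans _ _ (theta / (2 * a) * 2^-1)).
    by rewrite le_eqVlt; apply/orP; left; apply/eqP; field; lra.
  apply: ler_pM => //.
  by rewrite divr_ge0//; lra.
move=> h; have -> : a^-1 = 4 / theta * (theta / (4 * a)) by field; lra.
by apply: ler_wpM2l => //; rewrite divr_ge0//; lra.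
Qed.

Lemma sum_powR_tail m n : (0 < m)%N ->
  \sum_(m <= k < n) k%:R `^ (- (1 + theta)) <= 4 / theta * m%:R `^ (- theta) :> R.
Proof.
move=> m0; have t0 := theta_gt0.
have [nm|/ltnW mn] := leqP n m.
  by rewrite big_geq// mulr_ge0 ?powR_ge0// divr_ge0//; lra.
have H : \sum_(m <= k < n) k%:R `^ (- (1 + theta)) <=
    4 / theta * (m%:R `^ (- theta) - n%:R `^ (- theta)) :> R.
  elim: n mn => [|n IH]; first by rewrite leqNgt m0.
  rewrite leq_eqVlt => /predU1P[<-|mn]; first by rewrite big_geq// subrr mulr0.
  rewrite big_nat_recr//=.
  apply: (le_trans (lerD (IH mn) (powR_telescope_bound _))).
    by rewrite ler1n (leq_trans m0).
  by rewrite natr1 -mulrDr subrKA.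
apply: (le_trans H); apply: ler_wpM2l; first by rewrite divr_ge0//; lra.
by rewrite gerBl powR_ge0.
Qed.

Lemma cvg_natS_powRN : n.+1%:R `^ (- theta) @[n --> \oo] --> (0 : R).
Proof.
apply/cvgrPdist_le => e e0.
have ei0 : 0 <= e^-1 by rewrite invr_ge0 ltW.
near=> n; rewrite sub0r normrN ger0_norm ?powR_ge0// powRN.
rewrite -[leRHS]invrK lef_pV2 ?posrE ?invr_gt0// ?powR_gt0//.
have -> : e^-1 = (e^-1 `^ theta^-1) `^ theta.
  by rewrite -powRrM mulVf ?gt_eqF// powRr1.
apply: ge0_ler_powR; rewrite ?nnegrE ?powR_ge0//; first exact: ltW.
apply: (@le_trans _ _ n%:R); last by rewrite ler_nat.
by near: n; exact: nbhs_infty_ger.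
Unshelve. all: by end_near. Qed.

End power_sums.

Lemma ler_norm_sin (R : realType) (x : R) : `|sin x| <= `|x|.
Proof.
wlog x0 : x / 0 <= x => [H|].
  have [/H//|/ltW x0] := leP 0 x.
  by rewrite -normrN -sinN -(normrN x); apply: H; rewrite oppr_ge0.
have [c _] : exists2 c, c \in `[0, x] & sin x - sin 0 = cos c * (x - 0).
  apply: MVT_segment => //.
  by apply: continuous_subspaceT => y; exact: continuous_sin.
rewrite sin0 !subr0 => ->; rewrite normrM ler_piMl// ler_norml.
by rewrite cos_geN1 cos_le1.
Qed.

Lemma one_sub_cos (R : realType) (x : R) : 1 - cos x = 2 * sin (x / 2) ^+ 2.
Proof. by rewrite [x in cos x]splitr cosD -!expr2 cos2sin2; ring. Qed.

Lemma one_sub_cos_le (R : realType) (x : R) : 1 - cos x <= x ^+ 2 / 2.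
Proof.
rewrite one_sub_cos -[sin _ ^+ 2]real_normK ?num_real//.
have -> : x ^+ 2 / 2 = 2 * (`|x / 2| ^+ 2) by rewrite real_normK ?num_real//; field.
by rewrite ler_wpM2l// lerXn2r ?nnegrE// ler_norm_sin.
Qed.

Lemma one_sub_cos_le2 (R : realType) (x : R) : 1 - cos x <= 2.
Proof. by have := cos_geN1 x; lra. Qed.

Section cosine_series.
Variables (R : realType) (rho C1 : R) (c : R^nat).
Hypothesis rho_ge1 : 1 <= rho.
Hypothesis c_ge0 : forall k, 0 <= c k.
Hypothesis c_le : forall k, c k * k%:R `^ (1 + rho^-1) <= C1.

Let theta := rho^-1.
Let theta_gt0 : 0 < theta. Proof. by rewrite invr_gt0; move: rho_ge1; lra. Qed.
Let theta_le1 : theta <= 1.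
Proof. by rewrite /theta invf_le1//; move: rho_ge1; lra. Qed.

Definition cos_sum n x := \sum_(1 <= k < n.+1) c k * cos (k%:R * x).

Lemma C1_ge0 : 0 <= C1.
Proof. by apply: le_trans (c_le 0); rewrite mulr_ge0 ?powR_ge0. Qed.

Lemma coef_le k : (0 < k)%N -> c k <= C1 * k%:R `^ (- (1 + theta)).
Proof.
move=> k0; rewrite powRN ler_pdivlMr; first exact: c_le.
by rewrite powR_gt0// ltr0n.
Qed.

Lemma sum_coef_tail m n : (0 < m)%N ->
  \sum_(m <= k < n) c k <= C1 * (4 * rho) * m%:R `^ (- theta).
Proof.
move=> m0; apply: (@le_trans _ _ (\sum_(m <= k < n) C1 * k%:R `^ (- (1 + theta)))).
  by apply: ler_sum_nat => k /andP[mk _]; apply: coef_le; exact: leq_trans mk.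
rewrite -mulr_sumr -mulrA ler_wpM2l ?C1_ge0//.
have := @sum_powR_tail R theta theta_gt0 theta_le1 m n m0.
by rewrite {2}/theta invrK.
Qed.

Lemma cvg_cos_sum x : cvgn (cos_sum ^~ x).
Proof.
have -> : cos_sum ^~ x = series (fun k => c k.+1 * cos (k.+1%:R * x)).
  by apply/funext => n; rewrite /cos_sum /series/= big_add1.
apply: normed_cvg; apply: (@series_le_cvg _ _ (fun k => c k.+1)) => [k|k|k|] //.
- by rewrite /= normr_ge0.
- by rewrite /= normrM (ger0_norm (c_ge0 _)) ler_piMr// cos_max.
apply: nondecreasing_is_cvgn.
  by apply/nondecreasing_seqP => n; rewrite /series/= big_nat_recr//= lerDl.
exists (C1 * (4 * rho) * 1%:R `^ (- theta)) => _ [n _ <-].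
by rewrite /series/=; have := @sum_coef_tail 1 n.+1 isT; rewrite big_add1.
Qed.

Definition cos_series x := limn (cos_sum ^~ x).

Lemma cos_series_cvg x : cos_sum n x @[n --> \oo] --> cos_series x.
Proof. exact: cvg_cos_sum. Qed.

Lemma cos_seriesN x : cos_series (- x) = cos_series x.
Proof.
by congr (limn _); apply/funext => n; apply: eq_bigr => k _; rewrite mulrN cosN.
Qed.

Lemma cos_series_reflect x : cos_series (2 * pi - x) = cos_series x.
Proof.
congr (limn _); apply/funext => n; apply: eq_bigr => k _; congr (_ * _).
have -> : k%:R * (2 * pi - x) = (- (k%:R * x)) + pi *+ 2 *+ k.
  by rewrite -mulrnA -[pi *+ _]mulr_natr natrM; ring.
by rewrite (periodicn (@cosD2pi R)) cosN.
Qed.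

(* Terms with [k <= 1/x] are bounded by [1 - cos y <= y^2/2], the others by
   [1 - cos y <= 2]. *)
Lemma cos_sum_modulus0 n x : 0 < x ->
  cos_sum n 0 - cos_sum n x <= C1 * (1 + 8 * rho) * x `^ theta.
Proof.
move=> x0; have t0 := theta_gt0; have t1 := theta_le1.
have C0 := C1_ge0; have r1 := rho_ge1.
have -> : cos_sum n 0 - cos_sum n x =
    \sum_(1 <= k < n.+1) c k * (1 - cos (k%:R * x)).
  by rewrite -sumrB; apply: eq_bigr => k _; rewrite mulr0 cos0; ring.
have xi0 : 0 < x^-1 by rewrite invr_gt0.
pose N := Num.truncn x^-1.
have /andP[Nx xN] := Num.Theory.truncn_itv (ltW xi0).
rewrite -/N in Nx xN.
have one_sub_cos_ge0 y : 0 <= 1 - cos y :> R by rewrite subr_ge0 cos_le1.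
have low m : (m <= N)%N ->
    \sum_(1 <= k < m.+1) c k * (1 - cos (k%:R * x)) <= C1 * x `^ theta.
  move=> mN.
  apply: (@le_trans _ _ (\sum_(1 <= k < m.+1) C1 * (x ^+ 2 * (x^-1) `^ (1 - theta)))).
    apply: ler_sum_nat => k /andP[k1 km].
    have k0 : 0 < k%:R :> R by rewrite ltr0n.
    apply: (@le_trans _ _ (C1 * k%:R `^ (- (1 + theta)) * ((k%:R * x) ^+ 2))).
      apply: ler_pM => //; first exact: coef_le.
      by apply: le_trans (one_sub_cos_le _) _; have := sqr_ge0 (k%:R * x); lra.
    rewrite -mulrA ler_wpM2l//.
    rewrite exprMn mulrA [leRHS]mulrC; apply: ler_wpM2r; first exact: sqr_ge0.
    rewrite -powR_mulrn ?ler0n// -powRD; last by rewrite (gt_eqF k0) implybT.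
    have -> : - (1 + theta) + 2 = 1 - theta by ring.
    apply: ge0_ler_powR; rewrite ?nnegrE ?subr_ge0//; [exact: ltW|].
    by apply: le_trans Nx; rewrite ler_nat (leq_trans _ mN).
  rewrite big_const_nat iter_addr addr0 subn1/= -mulr_natl mulrCA ler_wpM2l//.
  apply: (@le_trans _ _ (x^-1 * (x ^+ 2 * x^-1 `^ (1 - theta)))).
    apply: ler_wpM2r; first by rewrite mulr_ge0 ?sqr_ge0 ?powR_ge0.
    by apply: le_trans Nx; rewrite ler_nat.
  have -> : x^-1 `^ (1 - theta) = x^-1 * x `^ theta.
    rewrite powRD; last by rewrite (gt_eqF xi0) implybT.
    rewrite powRr1 ?(ltW xi0)// -[x^-1 in X in _ * X](powR_inv1 (ltW x0)).
    by rewrite -powRrM mulN1r opprK.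
  by rewrite le_eqVlt; apply/orP; left; apply/eqP; field; rewrite gt_eqF.
have xt0 : 0 <= x `^ theta by exact: powR_ge0.
have lowN : C1 * x `^ theta <= C1 * (1 + 8 * rho) * x `^ theta.
  by apply: ler_wpM2r => //; rewrite ler_peMr//; lra.
have [nN|Nn] := leqP n N; first by apply: (le_trans (low _ nN)).
rewrite (@big_cat_nat _ _ _ N.+1)//=; last exact: ltnW.
apply: (@le_trans _ _ (C1 * x `^ theta + 2 * (C1 * (4 * rho) * x `^ theta))); last first.
  by rewrite le_eqVlt; apply/orP; left; apply/eqP; ring.
apply: lerD; first exact: low.
apply: (@le_trans _ _ (2 * \sum_(N.+1 <= k < n.+1) c k)).
  rewrite mulr_sumr; apply: ler_sum_nat => k _; rewrite mulrC ler_wpM2r//.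
  exact: one_sub_cos_le2.
apply: ler_wpM2l => //; apply: (le_trans (sum_coef_tail _ _)) => //.
apply: ler_wpM2l; first by rewrite !mulr_ge0//; lra.
rewrite powRN -[leRHS]invrK lef_pV2 ?posrE ?invr_gt0 ?powR_gt0//.
rewrite -powRN -[x in X in X <= _]invrK.
have -> : (x^-1)^-1 `^ (- theta) = x^-1 `^ theta.
  by rewrite -(powR_inv1 (ltW xi0)) -powRrM mulrN mulN1r opprK.
by apply: ge0_ler_powR; rewrite ?nnegrE//; exact: ltW.
Qed.

Lemma cos_series_modulus0 x : 0 <= x ->
  cos_series 0 - cos_series x <= C1 * (1 + 8 * rho) * x `^ theta.
Proof.
rewrite le_eqVlt => /predU1P[<-|x0].
  rewrite subrr mulr_ge0 ?powR_ge0// mulr_ge0 ?C1_ge0//.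
  by move: rho_ge1; lra.
have H : cos_sum n 0 - cos_sum n x @[n --> \oo] --> cos_series 0 - cos_series x.
  by apply: cvgB; exact: cos_series_cvg.
apply: (cvgr_to_le H).
by apply: nearW => n; exact: cos_sum_modulus0.
Qed.

End cosine_series.

(** * Convexity of cosine series *)

Section trigonometric_sums.
Variable R : realType.
Implicit Types (a b d : R^nat) (x p q h : R).

Lemma second_difference (g g1 g2 : R -> R) p q h :
    (forall x, is_derive x 1 g (g1 x)) -> (forall x, is_derive x 1 g1 (g2 x)) ->
    p <= q -> 0 <= h ->
  exists2 xi, p <= xi <= q + h &
    (g (q + h) - g q) - (g (p + h) - g p) = g2 xi * (h * (q - p)).
Proof.
move=> dg dg1 pq h0.
have dcont (f f' : R -> R) A : (forall x, is_derive x 1 f (f' x)) -> {within A, continuous f}.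
  move=> df; apply: continuous_subspaceT => x; apply: differentiable_continuous.
  by apply/derivable1_diffP; have [] := df x.
have dgh x : is_derive x 1 (fun y => g (y + h) - g y) (g1 (x + h) - g1 x).
  apply: is_deriveB; have -> : (fun y => g (y + h)) = g \o (id + cst h) by [].
  have dxh : is_derive x 1 (id + cst h) (1 + 0 : R) by apply: is_deriveD.
  apply: (is_derive_eq (is_derive1_comp (dg _) dxh)).
  by rewrite addr0 mulr1.
have [c] := @MVT_segment _ _ _ _ _ pq (fun x _ => dgh x) (dcont _ _ _ dgh).
rewrite in_itv/= => /andP[pc cq] ->.
have ch : c <= c + h by rewrite lerDl.
have [e] := @MVT_segment _ _ _ _ _ ch (fun x _ => dg1 x) (dcont _ _ _ dg1).
rewrite in_itv/= => /andP[ce ech] ->.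
exists e; last by ring.
by apply/andP; split; lra.
Qed.

Lemma is_derive_cos_poly d n x :
  is_derive x 1 (fun y => \sum_(1 <= k < n.+1) d k * cos (k%:R * y))
    (\sum_(1 <= k < n.+1) - (k%:R * d k) * sin (k%:R * x)).
Proof.
elim: n => [|n IH].
  under eq_fun do rewrite big_nil; rewrite big_nil; exact: is_derive_cst.
under eq_fun do rewrite big_nat_recr//=; rewrite big_nat_recr//=.
apply: is_deriveD.
have -> : (fun y => d n.+1 * cos (n.+1%:R * y)) = d n.+1 \*: (cos \o (n.+1%:R \*: id)) by [].
apply: is_derive_eq.
rewrite /= /GRing.scale/=; ring.
Qed.

Lemma is_derive_sin_poly d n x :
  is_derive x 1 (fun y => \sum_(1 <= k < n.+1) d k * sin (k%:R * y))
    (\sum_(1 <= k < n.+1) (k%:R * d k) * cos (k%:R * x)).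
Proof.
elim: n => [|n IH].
  under eq_fun do rewrite big_nil; rewrite big_nil; exact: is_derive_cst.
under eq_fun do rewrite big_nat_recr//=; rewrite big_nat_recr//=.
apply: is_deriveD.
have -> : (fun y => d n.+1 * sin (n.+1%:R * y)) = d n.+1 \*: (sin \o (n.+1%:R \*: id)) by [].
apply: is_derive_eq.
rewrite /= /GRing.scale/=; ring.
Qed.

Lemma telescope2E b k :
  telescope (telescope b) k = b k.+2 - 2 * b k.+1 + b k.
Proof. by rewrite /telescope/=; ring. Qed.

(* [2 (1 - cos x) cos kx] is minus the second difference of [cos kx] in [k];
   the differences are moved onto [b]. *)
Lemma cos_sum_by_parts b n x : b 0%N = 0 ->
  2 * (1 - cos x) * \sum_(1 <= k < n.+1) b k * cos (k%:R * x) =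
  \sum_(k < n) - telescope (telescope b) k * (cos (k.+1%:R * x) - 1)
  + b n.+1 * (cos (n%:R * x) - 1) - b n * (cos (n.+1%:R * x) - 1).
Proof.
move=> b0; elim: n => [|n IH].
  by rewrite big_nil big_ord0 mul0r cos0 b0; ring.
rewrite big_nat_recr//= mulrDr IH big_ord_recr/= telescope2E.
have -> : cos (n.+2%:R * x) = 2 * cos x * cos (n.+1%:R * x) - cos (n%:R * x).
  have -> : n.+2%:R * x = n.+1%:R * x + x by rewrite -[n.+2%:R]natr1; ring.
  have -> : n%:R * x = n.+1%:R * x - x by rewrite -[n.+1%:R]natr1; ring.
  by rewrite cosD cosB; ring.
by move: (\sum_(k < n) _) => A; ring.
Qed.

Lemma norm_cosB_le (e u v : R) : 0 < e ->
  `|cos u - cos v| <= e + (1 - cos (u - v)) / (2 * e).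
Proof.
move=> e0; set m := (u + v) / 2; set w := (u - v) / 2.
have -> : u - v = w + w by rewrite /w; field.
have -> : u = m + w by rewrite /m /w; field.
have -> : v = m - w by rewrite /m /w; field.
have -> : cos (m + w) - cos (m - w) = - 2 * sin m * sin w by rewrite cosD cosB; ring.
have -> : 1 - cos (w + w) = 2 * sin w ^+ 2.
  by rewrite one_sub_cos (_ : (w + w) / 2 = w)//; field.
apply: (@le_trans _ _ (2 * `|sin w|)).
  rewrite !normrM normrN (ger0_norm (ler0n _ 2)) -mulrA ler_wpM2l//.
  by rewrite ler_piMl// ler_norml sin_geN1 sin_le1.
rewrite -[sin w ^+ 2]real_normK ?num_real//; set z := `|sin w|.
have -> : e + 2 * z ^+ 2 / (2 * e) = 2 * z + (z - e) ^+ 2 / e by field; lra.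
by rewrite lerDl divr_ge0 ?sqr_ge0// ltW.
Qed.

End trigonometric_sums.

Lemma concave_seq_nondecreasing (R : realType) (b : R^nat) :
  (forall k, 0 <= b k) -> (forall k, telescope (telescope b) k <= 0) ->
  nondecreasing_seq b.
Proof.
move=> b0 b2; apply/nondecreasing_seqP => m; rewrite leNgt; apply/negP => bm.
have d_le n : b (m + n)%N.+1 - b (m + n)%N <= b m.+1 - b m.
  elim: n => [|n IH]; first by rewrite addn0.
  by have := b2 (m + n)%N; rewrite telescope2E addnS; lra.
have b_le n : b (m + n)%N <= b m - n%:R * (b m - b m.+1).
  elim: n => [|n IH]; first by rewrite addn0 mul0r subr0.
  by have := d_le n; rewrite addnS -natr1; lra.
have e0 : 0 < b m - b m.+1 by lra.
have := truncnS_gt (b m / (b m - b m.+1)).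
set N := (Num.truncn _).+1; rewrite ltr_pdivrMr// => bN.
by have := b_le N; have := b0 (m + N)%N; lra.
Qed.

Section cosine_series_convexity.
Variables (R : realType) (rho C1 : R) (c : R^nat).
Hypothesis rho_ge1 : 1 <= rho.
Hypothesis c_ge0 : forall k, 0 <= c k.
Hypothesis c_le : forall k, c k * k%:R `^ (1 + rho^-1) <= C1.
Hypothesis c_concave :
  forall k, telescope (telescope (fun n => n%:R ^+ 2 * c n)) k <= 0.

Let theta := rho^-1.
Let theta_gt0 : 0 < theta. Proof. by rewrite invr_gt0; move: rho_ge1; lra. Qed.
Let theta_le1 : theta <= 1.
Proof. by rewrite /theta invf_le1//; move: rho_ge1; lra. Qed.

Local Notation f := (cos_series c).
Let b n : R := n%:R ^+ 2 * c n.
Let w n k : R := 1 - k%:R / n.+1%:R.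

Let b_nd : nondecreasing_seq b.
Proof.
by apply: concave_seq_nondecreasing => // k; rewrite mulr_ge0 ?sqr_ge0.
Qed.

Let b_ge0 k : 0 <= b k. Proof. by rewrite mulr_ge0 ?sqr_ge0. Qed.

Let fejer n x := \sum_(1 <= k < n.+1) (w n k * c k) * cos (k%:R * x).

Let cvg_fejer x : fejer n x @[n --> \oo] --> f x.
Proof.
suff -> : fejer ^~ x = arithmetic_mean (cos_sum c ^~ x).
  apply: (@cesaro R).
  exact: (cos_series_cvg rho_ge1 c_ge0 c_le).
apply/funext => n; rewrite /arithmetic_mean/= /series/=.
have -> m : \sum_(0 <= i < m) cos_sum c i x =
    \sum_(1 <= k < m) (m%:R - k%:R) * (c k * cos (k%:R * x)).
  elim: m => [|[|m] IH]; first by rewrite !big_geq.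
    by rewrite big_nat1 /cos_sum !big_geq.
  rewrite big_nat_recr//= IH /cos_sum [in RHS]big_nat_recr//=.
  rewrite [X in _ + X]big_nat_recr//= addrA -big_split/=; congr (_ + _).
    by apply: eq_bigr => k _; rewrite -[m.+2%:R]natr1; ring.
  by rewrite -[m.+2%:R]natr1; ring.
rewrite mulr_sumr; apply: eq_bigr => k _; rewrite /w.
have : n.+1%:R != 0 :> R by rewrite pnatr_eq0.
by move: n.+1%:R => N N0; field.
Qed.

Let fejer2_le n x :
  (1 - cos x) * (\sum_(1 <= k < n.+1) (w n k * b k) * cos (k%:R * x)) <= b n / n.+1%:R.
Proof.
have key (u v S T A : R) : 2 * u * S = T - A * v -> T <= 0 -> - (A * v) <= 2 * A ->
  u * S <= A by lra.
have n0 : 0 < n.+1%:R :> R by rewrite ltr0n.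
have wn : w n n.+1 = 0 by rewrite /w divff ?subrr// gt_eqF.
have wn' : w n n = n.+1%:R^-1.
  rewrite /w (_ : n%:R = n.+1%:R - 1); last by rewrite -natr1 addrK.
  by move: (n.+1%:R) n0 => N N0; field; rewrite gt_eqF.
have b0 : b 0%N = 0 by rewrite /b expr0n mul0r.
have := @cos_sum_by_parts R (fun k => w n k * b k) n x.
rewrite b0 mulr0 => /(_ erefl); rewrite wn !mul0r addr0 wn' => H.
have wb2 k : (k < n)%N -> telescope (telescope (fun k => w n k * b k)) k <= 0.
  move=> kn; rewrite telescope2E.
  have -> : w n k.+2 * b k.+2 - 2 * (w n k.+1 * b k.+1) + w n k * b k =
      w n k.+1 * (b k.+2 - 2 * b k.+1 + b k) - (b k.+2 - b k) / n.+1%:R.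
    by rewrite /w -[k.+2%:R]natr1 -[k.+1%:R]natr1; ring.
  have w0 : 0 <= w n k.+1 by rewrite subr_ge0 ler_pdivrMr// mul1r ler_nat ltnW.
  have cc : b k.+2 - 2 * b k.+1 + b k <= 0 by rewrite -telescope2E; exact: c_concave.
  have : 0 <= (b k.+2 - b k) / n.+1%:R by rewrite divr_ge0// subr_ge0; apply: b_nd; rewrite ltnW.
  by rewrite subr_le0; apply: le_trans; exact: mulr_ge0_le0.
have S0 : \sum_(k < n) - telescope (telescope (fun k => w n k * b k)) k *
    (cos (k.+1%:R * x) - 1) <= 0.
  apply: sumr_le0 => k _; rewrite mulNr oppr_le0; apply: mulr_le0; first exact: wb2.
  by rewrite subr_le0 cos_le1.
have bn0 : 0 <= n.+1%:R^-1 * b n by rewrite mulr_ge0 ?invr_ge0// ltW.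
have : - (n.+1%:R^-1 * b n * (cos (n.+1%:R * x) - 1)) <= 2 * (n.+1%:R^-1 * b n).
  rewrite -mulrN mulrC; apply: ler_wpM2r => //.
  by rewrite opprB one_sub_cos_le2.
by rewrite [b n / _]mulrC; exact: key H S0.
Qed.

Let b_mean_le n : b n / n.+1%:R <= C1 * n.+1%:R `^ (- theta).
Proof.
have C0 := C1_ge0 c_ge0 c_le.
case: n => [|n]; first by rewrite /b expr0n !mul0r mulr_ge0 ?powR_ge0.
have n0 : 0 < n.+2%:R :> R by rewrite ltr0n.
have n1 : 0 < n.+1%:R :> R by rewrite ltr0n.
rewrite ler_pdivrMr// -mulrA.
have -> : n.+2%:R `^ (- theta) * n.+2%:R = n.+2%:R `^ (1 - theta).
  rewrite -{2}[n.+2%:R]powRr1 ?(ltW n0)// -powRD ?(gt_eqF n0) ?implybT//.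
  by rewrite addrC.
have h : b n.+1 <= C1 * n.+1%:R `^ (1 - theta).
  rewrite /b mulrC; apply: le_trans (ler_wpM2r (sqr_ge0 _) (coef_le c_le _)) _ => //.
  rewrite -mulrA -powR_mulrn ?(ltW n1)// -powRD ?(gt_eqF n1) ?implybT//.
  by have -> : - (1 + rho^-1) + 2 = 1 - theta by rewrite /theta; ring.
apply: (le_trans h); apply: ler_wpM2l => //.
by apply: ge0_ler_powR; rewrite ?nnegrE ?subr_ge0 ?(ltW n0) ?(ltW n1)// ler_nat.
Qed.

Let convex_interior (p q h : R) : 0 < p -> p <= q -> 0 <= h -> q + h < 2 * pi ->
  f (p + h) - f p <= f (q + h) - f q.
Proof.
move=> p0 pq h0 qh; have C0 := C1_ge0 c_ge0 c_le.
have cos_lt1 (y : R) : 0 < y -> y <= pi -> cos y < 1 :> R.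
  move=> y0 ypi; rewrite -cos0 ltr_cos// in_itv/= ?lexx ?pi_ge0//.
  by rewrite ypi ltW.
have cos_anti (y z : R) : 0 <= y -> y <= z -> z <= pi -> cos z <= cos y :> R.
  move=> y0; rewrite le_eqVlt => /predU1P[->//|yz] zpi.
  by apply: ltW; rewrite ltr_cos// in_itv/=; apply/andP; split; lra.
have cos_reflect y : cos (2 * pi - y) = cos y :> R.
  have -> : 2 * pi - y = - y + pi *+ 2 by rewrite -mulr_natl; ring.
  by rewrite cosD2pi cosN.
have [kappa kappa0 kappa_le] : exists2 kappa : R, 0 < kappa &
    forall y, p <= y <= q + h -> kappa <= 1 - cos y.
  pose u := Num.min p pi; pose v := Num.min (2 * pi - (q + h)) pi.
  have pi0 : 0 < pi :> R := pi_gt0 R.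
  have [u0 u1] : 0 < u /\ u <= pi by rewrite lt_min ge_min lexx orbT p0.
  have [v0 v1] : 0 < v /\ v <= pi.
    by rewrite lt_min ge_min lexx orbT pi0 andbT; split=> //; lra.
  exists (Num.min (1 - cos u) (1 - cos v)).
    by rewrite lt_min !subr_gt0 !cos_lt1.
  move=> y /andP[py yq]; rewrite ge_min; have [ypi|/ltW piy] := leP y pi.
    by rewrite lerD2l lerN2 cos_anti ?(ltW u0)// ge_min py.
  rewrite [X in _ || X]lerD2l lerN2 -(cos_reflect y) [X in _ || X]cos_anti ?orbT//.
  - exact: ltW.
  - by rewrite ge_min; apply/orP; left; lra.
  - lra.
have D2 n : - (h * (q - p) / kappa * C1) * n.+1%:R `^ (- theta) <=
    (fejer n (q + h) - fejer n q) - (fejer n (p + h) - fejer n p).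
  have dF := is_derive_cos_poly (fun k => w n k * c k) n.
  have dF1 := is_derive_sin_poly (fun k => - (k%:R * (w n k * c k))) n.
  have [xi xipq ->] := @second_difference _ (fejer n) _ _ _ _ _ dF dF1 pq h0.
  have -> : \sum_(1 <= k < n.+1) k%:R * - (k%:R * (w n k * c k)) * cos (k%:R * xi)
     = - \sum_(1 <= k < n.+1) (w n k * b k) * cos (k%:R * xi).
    by rewrite -sumrN; apply: eq_bigr => k _; rewrite /b; ring.
  set S := \sum_(1 <= k < n.+1) _.
  have S_le : S <= C1 * n.+1%:R `^ (- theta) / kappa.
    have [S0|S0] := leP S 0.
      by rewrite (le_trans S0)// divr_ge0 ?mulr_ge0 ?powR_ge0// ltW.
    rewrite ler_pdivlMr// mulrC; apply: le_trans (b_mean_le n).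
    apply: le_trans (fejer2_le n xi).
    by apply: ler_wpM2r; [exact: ltW|exact: kappa_le].
  have hq : 0 <= h * (q - p) by rewrite mulr_ge0// subr_ge0.
  rewrite !mulNr lerN2; apply: (le_trans (ler_wpM2r hq S_le)).
  by rewrite le_eqVlt; apply/orP; left; apply/eqP; ring.
have L : - (h * (q - p) / kappa * C1) * n.+1%:R `^ (- theta) @[n --> \oo] --> (0 : R).
  rewrite -[X in _ --> X](mulr0 (- (h * (q - p) / kappa * C1))).
  by apply: cvgMr; exact: cvg_natS_powRN.
rewrite -subr_ge0.
have H : (fejer n (q + h) - fejer n q) - (fejer n (p + h) - fejer n p) @[n --> \oo] -->
    (f (q + h) - f q) - (f (p + h) - f p).
  by apply: cvgB; apply: cvgB; exact: cvg_fejer.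
by apply: (ler_cvg_to L H); apply: nearW.
Qed.

Let M := f 0 + C1 * (1 + 8 * rho) / 2.

(* Positive definiteness turns the modulus at [0] into a modulus everywhere. *)
Lemma cos_series_modulus (x y : R) : x != y ->
  `|f x - f y| <= M * `|x - y| `^ (theta / 2).
Proof.
move=> xy; have d0 : 0 < `|x - y| by rewrite normr_gt0 subr_eq0.
set d := `|x - y| in d0 *; pose e := d `^ (theta / 2).
have e0 : 0 < e by rewrite powR_gt0.
have f0d z : f `|z| = f z by case: (ger0P z); rewrite ?cos_seriesN.
have cvg_f := cos_series_cvg rho_ge1 c_ge0 c_le.
have L : `|cos_sum c n x - cos_sum c n y| @[n --> \oo] --> `|f x - f y|.
  by apply: cvg_norm; apply: cvgB; exact: cvg_f.
have U : e * cos_sum c n 0 + (cos_sum c n 0 - cos_sum c n (x - y)) / (2 * e)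
    @[n --> \oo] --> e * f 0 + (f 0 - f (x - y)) / (2 * e).
  apply: cvgD; first by apply: cvgMr; exact: cvg_f.
  by apply: cvgMl; apply: cvgB; exact: cvg_f.
apply: (@le_trans _ _ (e * f 0 + (f 0 - f (x - y)) / (2 * e))).
  apply: (ler_cvg_to L U); apply: nearW => n.
  rewrite /cos_sum -!sumrB mulr_suml mulr_sumr -big_split/=.
  apply: (le_trans (ler_norm_sum _ _ _)); apply: ler_sum => k _.
  rewrite -mulrBr normrM (ger0_norm (c_ge0 k)) mulr0 cos0.
  have := norm_cosB_le (k%:R * x) (k%:R * y) e0; rewrite -mulrBr => H.
  apply: (le_trans (ler_wpM2l (c_ge0 k) H)).
  by rewrite le_eqVlt; apply/orP; left; apply/eqP; ring.
rewrite -/e /M [leRHS]mulrDl [e * _]mulrC lerD2l -(f0d (x - y)) -/d.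
have := cos_series_modulus0 rho_ge1 c_ge0 c_le (ltW d0).
have -> : d `^ rho^-1 = e * e.
  by rewrite -powRD; [rewrite -splitr|rewrite (gt_eqF d0) implybT].
move=> H; rewrite ler_pdivrMr ?mulr_gt0//; apply: (le_trans H).
by rewrite le_eqVlt; apply/orP; left; apply/eqP; field.
Qed.

Lemma cos_series_convex (p q h : R) : 0 <= p -> p <= q -> 0 <= h -> q + h <= 2 * pi ->
  f (p + h) - f p <= f (q + h) - f q.
Proof.
move=> p0 pq h0 qh; have C0 := C1_ge0 c_ge0 c_le.
have pi0 : 0 < pi :> R := pi_gt0 R.
pose s n (x : R) := x - (x - pi) / n.+1%:R.
have near_f n (x : R) : 0 <= x <= 2 * pi ->
    `|f (s n x) - f x| <= `|M| * pi `^ (theta / 2) * n.+1%:R `^ (- (theta / 2)).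
  move=> /andP[x0 x2].
  have [->|sx] := eqVneq (s n x) x.
    by rewrite subrr normr0 !mulr_ge0 ?powR_ge0.
  apply: (le_trans (cos_series_modulus sx)).
  apply: (@le_trans _ _ (`|M| * `|s n x - x| `^ (theta / 2))).
    by apply: ler_wpM2r; [exact: powR_ge0|exact: ler_norm].
  rewrite -mulrA ler_wpM2l//.
  have -> : n.+1%:R `^ (- (theta / 2)) = n.+1%:R^-1 `^ (theta / 2) :> R.
    by rewrite -(powR_inv1 (ler0n R n.+1)) -powRrM mulN1r.
  rewrite -powRM ?invr_ge0//; last exact: ltW.
  have t2 : 0 <= theta / 2 by rewrite divr_ge0// ltW.
  apply: (ge0_ler_powR t2); rewrite ?nnegrE ?mulr_ge0 ?invr_ge0//; first exact: ltW.
  have -> : s n x - x = - ((x - pi) / n.+1%:R) by rewrite /s; ring.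
  rewrite normrN normrM [X in _ * X]ger0_norm ?invr_ge0// ler_wpM2r ?invr_ge0//.
  by rewrite ler_norml; apply/andP; split; lra.
set K := `|M| * _ in near_f.
have s_in n (x : R) : 0 <= x -> x <= 2 * pi -> 0 < s n.+1 x /\ s n.+1 x < 2 * pi.
  move=> x0 x2; have l0 : 0 < n.+2%:R^-1 :> R by rewrite invr_gt0 ltr0n.
  have l2 : n.+2%:R^-1 <= 2^-1 :> R by rewrite lef_pV2 ?posrE ?ltr0n// ler_nat.
  rewrite /s; move: n.+2%:R^-1 l0 l2 => l l0 l2.
  have := mulr_gt0 pi0 l0; have l1 : 0 <= 1 - l by lra.
  have := mulr_ge0 x0 l1; have x2' : 0 <= 2 * pi - x by rewrite subr_ge0.
  by have := mulr_ge0 x2' l1; split; lra.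
rewrite -subr_ge0; set D := _ - _.
have D_ge n : - 4 * (K * n.+2%:R `^ (- (theta / 2))) <= D.
  pose r : R := 1 - n.+2%:R^-1.
  have r0 : 0 <= r by rewrite subr_ge0 invf_le1// ler1n.
  have sD x : s n.+1 (x + h) = s n.+1 x + r * h by rewrite /s /r; ring.
  have sB : s n.+1 q - s n.+1 p = r * (q - p) by rewrite /s /r; ring.
  have q0 : 0 <= q by exact: le_trans pq.
  have q2 : q <= 2 * pi by apply: le_trans qh; rewrite lerDl.
  have [sp _] := s_in n p p0 (le_trans pq q2).
  have [_ sq] := s_in n (q + h) (addr_ge0 (le_trans p0 pq) h0) qh.
  have spq : s n.+1 p <= s n.+1 q by rewrite -subr_ge0 sB mulr_ge0// subr_ge0.
  have := @convex_interior (s n.+1 p) (s n.+1 q) (r * h) sp spq (mulr_ge0 r0 h0).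
  rewrite -!sD => /(_ sq) cvx.
  have near4 (x : R) : 0 <= x -> x <= 2 * pi -> `|f (s n.+1 x) - f x| <=
      K * n.+2%:R `^ (- (theta / 2)) by move=> x0 x2; apply: near_f; rewrite x0.
  have ph2 : p + h <= 2 * pi by apply: le_trans qh; rewrite lerD2r.
  have := near4 _ (addr_ge0 q0 h0) qh; have := near4 _ q0 q2.
  have := near4 _ (addr_ge0 p0 h0) ph2; have := near4 _ p0 (le_trans pq q2).
  rewrite !ler_norml => /andP[a1 a2] /andP[b1 b2] /andP[c1 c2] /andP[d1 d2].
  move: cvx a1 a2 b1 b2 c1 c2 d1 d2; rewrite /D.
  move: (K * _) => KK; lra.
have L : - 4 * (K * n.+2%:R `^ (- (theta / 2))) @[n --> \oo] --> (0 : R).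
  rewrite -[X in _ --> X](mulr0 (- 4)); apply: cvgMr.
  rewrite -[X in _ --> X](mulr0 K); apply: cvgMr.
  rewrite (cvg_shiftS (fun n => n.+1%:R `^ (- (theta / 2)))).
  by apply: cvg_natS_powRN; rewrite divr_gt0.
by apply: (cvgr_to_le L); apply: nearW.
Qed.

End cosine_series_convexity.

(** * Covariance of random Fourier series *)

Section square_integrable.
Context (R : realType) (d : measure_display) (T : measurableType d)
        (P : probability T R).
Implicit Types X Z : T -> R.

Local Notation L2 := (Lfun P 2%:E).
Let norm2 (X : T -> R) : R := fine ('N[P]_2%:E[EFin \o X])%E.

Lemma Lfun2P X : measurable_fun setT X -> ('N[P]_2%:E[EFin \o X] < +oo)%E -> X \in L2.
Proof. by move=> mX nX; rewrite inE; apply/andP; split; rewrite inE. Qed.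

Lemma Lfun2_measurable X : X \in L2 -> measurable_fun setT X.
Proof. by rewrite inE => /andP[]; rewrite inE. Qed.

Lemma Lfun2_Lnorm X : X \in L2 -> (('N[P]_2%:E[EFin \o X])%E = (norm2 X)%:E)%E.
Proof.
rewrite inE => /andP[_]; rewrite inE /= /finite_norm => X2.
by rewrite fineK// ge0_fin_numE// Lnorm_ge0.
Qed.

Lemma Lfun2D X Z : X \in L2 -> Z \in L2 -> X \+ Z \in L2.
Proof. by move=> X2 Z2; apply: rpredD => //; rewrite lee1n. Qed.

Lemma Lfun1D X Z : X \in Lfun P 1 -> Z \in Lfun P 1 -> X \+ Z \in Lfun P 1.
Proof. by move=> X1 Z1; apply: rpredD. Qed.

Lemma Lfun2B X Z : X \in L2 -> Z \in L2 -> X \- Z \in L2.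
Proof. by move=> X2 Z2; apply: rpredB => //; rewrite lee1n. Qed.

Lemma Lfun2_sum (I : Type) (r : seq I) (a : I -> R) (Y : I -> T -> R) :
  (forall k, Y k \in L2) -> (fun w => \sum_(k <- r) a k * Y k w) \in L2.
Proof.
move=> Y2; elim: r => [|k r IH].
  by under eq_fun do rewrite big_nil; exact: Lfun_cst.
under eq_fun do rewrite big_cons mulrC.
by apply: (@Lfun2D (a k \o* Y k)) => //; apply: Lfun_scale; rewrite ?ler1n.
Qed.

Lemma expectation_lincomb (I : Type) (r : seq I) (a e : I -> R) (W : I -> T -> R) :
    (forall k, W k \in Lfun P 1) -> (forall k, 'E_P[W k] = (e k)%:E)%E ->
  ('E_P[fun w => (\sum_(k <- r) a k * W k w)%R] = (\sum_(k <- r) a k * e k)%:E)%E.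
Proof.
move=> W1 We.
suff [] : (fun w => \sum_(k <- r) a k * W k w) \in Lfun P 1 /\
  ('E_P[fun w => (\sum_(k <- r) a k * W k w)%R] = (\sum_(k <- r) a k * e k)%:E)%E by [].
elim: r => [|k r [IH1 IH2]].
  under eq_fun do rewrite big_nil; rewrite big_nil; split; last exact: expectation_cst.
  exact: Lfun_cst.
have k1 : a k \o* W k \in Lfun P 1 by apply: (@Lfun_scale _ _ _ _ _ _ 1).
have -> : (fun w => \sum_(l <- k :: r) a l * W l w) =
    (a k \o* W k) \+ (fun w => \sum_(l <- r) a l * W l w).
  by apply/funext => w; rewrite big_cons/= mulrC.
split; last by rewrite expectationD// expectationZl// IH2 We big_cons EFinD EFinM.
exact: rpredD.
Qed.

Lemma expectationM_norm2 X Z : X \in L2 -> Z \in L2 ->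
  `|fine 'E_P[(X \* Z)%R]| <= norm2 X * norm2 Z.
Proof.
move=> X2 Z2; have XZ1 := Lfun2_mul_Lfun1 X2 Z2.
rewrite -lee_fin EFinM -!Lfun2_Lnorm//.
have mX := Lfun2_measurable X2; have mZ := Lfun2_measurable Z2.
apply: le_trans (hoelder P mX mZ _ _ _) => //; last by rewrite [RHS]splitr !div1r.
have -> : (`|fine 'E_P[(X \* Z)%R]|%:E = `|'E_P[(X \* Z)%R]|)%E.
  by rewrite -[in RHS](fineK (expectation_fin_num XZ1)).
rewrite unlock Lnorm1; apply: le_abse_integral => //.
by have /Lfun1_integrable/integrableP[] := XZ1.
Qed.

Lemma Lfun2_limit (U : nat -> T -> R) X : measurable_fun setT X ->
    (forall n, U n \in L2) ->
    ('N[P]_2%:E[EFin \o (U n \- X)%R] @[n --> \oo] --> 0)%E ->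
  X \in L2.
Proof.
move=> mX U2 /fine_cvgP[[n _ Un] _].
have UX2 : U n \- X \in L2.
  apply: Lfun2P; first exact: measurable_funB (Lfun2_measurable (U2 n)) mX.
  by have := Un n (leqnn n); rewrite ge0_fin_numE ?Lnorm_ge0.
have -> : X = U n \- (U n \- X) by apply/funext => w /=; ring.
exact: Lfun2B.
Qed.

Lemma cvg_expectationM (U V : nat -> T -> R) X Z :
    (forall n, U n \in L2) -> (forall n, V n \in L2) -> X \in L2 -> Z \in L2 ->
    ('N[P]_2%:E[EFin \o (U n \- X)%R] @[n --> \oo] --> 0)%E ->
    ('N[P]_2%:E[EFin \o (V n \- Z)%R] @[n --> \oo] --> 0)%E ->
  fine ('E_P[(U n \* V n)%R])%E @[n --> \oo] --> fine ('E_P[(X \* Z)%R])%E.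
Proof.
move=> U2 V2 X2 Z2 /fine_cvg/= UX /fine_cvg/= VZ.
pose E n := norm2 (U n \- X) * norm2 (V n \- Z) + norm2 X * norm2 (V n \- Z)
  + norm2 (U n \- X) * norm2 Z.
have E0 : E n @[n --> \oo] --> (0 : R).
  rewrite [X in _ --> X](_ : 0 = 0 * 0 + norm2 X * 0 + 0 * norm2 Z); last by ring.
  apply: cvgD; first apply: cvgD; first exact: cvgM.
    by apply: cvgM => //; exact: cvg_cst.
  by apply: cvgM => //; exact: cvg_cst.
have fineD_ W1 W2 : W1 \in Lfun P 1 -> W2 \in Lfun P 1 ->
    fine ('E_P[(W1 \+ W2)%R])%E = fine ('E_P[W1])%E + fine ('E_P[W2])%E.
  by move=> ? ?; rewrite expectationD// fineD// expectation_fin_num.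
have dist n : `|fine ('E_P[(U n \* V n)%R])%E - fine ('E_P[(X \* Z)%R])%E| <= E n.
  have UX2 := Lfun2B (U2 n) X2; have VZ2 := Lfun2B (V2 n) Z2.
  have -> : U n \* V n = (((U n \- X) \* (V n \- Z)) \+ (X \* (V n \- Z)))
      \+ ((U n \- X) \* Z) \+ (X \* Z) by apply/funext => w /=; ring.
  have m1 := Lfun2_mul_Lfun1 UX2 VZ2; have m2 := Lfun2_mul_Lfun1 X2 VZ2.
  have m3 := Lfun2_mul_Lfun1 UX2 Z2; have m4 := Lfun2_mul_Lfun1 X2 Z2.
  have m12 := Lfun1D m1 m2; have m123 := Lfun1D m12 m3.
  rewrite !fineD_// addrK; apply: (le_trans (ler_normD _ _)).
  by apply: lerD; [apply: (le_trans (ler_normD _ _)); apply: lerD|];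
    exact: expectationM_norm2.
apply/subr_cvg0; apply: norm_cvg0.
apply: (squeeze_cvgr _ (cvg_cst 0) E0).
by apply: nearW => n; rewrite normr_ge0 dist.
Qed.

End square_integrable.

Section covariance.
Context (R : realType) (d : measure_display) (T : measurableType d)
        (P : probability T R).
Variables (alpha : int -> R) (Y : int -> {RV P >-> R}) (Psi : R -> {RV P >-> R}).
Hypothesis Y_orthonormal :
  forall k l : int, ('E_P[(Y k \* Y l)%R] = (k == l)%:R%:E)%E.
Hypothesis Psi_series : is_random_fourier_series alpha Y Psi.

Lemma orthonormal_Lfun2 k : (Y k : T -> R) \in Lfun P 2%:E.
Proof.
apply: Lfun2P => //; have := Y_orthonormal k k; rewrite eqxx unlock => E1.
rewrite unlock; apply: poweR_lty.
rewrite (eq_integral (fun w => (Y k w * Y k w)%:E)) ?E1 ?ltry// => w _.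
by rewrite /= powR_mulrn// real_normK ?num_real// expr2.
Qed.

Fixpoint frequencies n : seq int :=
  if n is m.+1 then frequencies m ++ [:: n%:Z; - n%:Z] else [:: 0].

Lemma frequenciesS n :
  frequencies n.+1 = frequencies n ++ [:: n.+1%:Z; - n.+1%:Z].
Proof. by []. Qed.

Definition fourier_coef t (k : int) : R :=
  if k == 0 then alpha 0 / 2
  else alpha k * (if 0 < k then sin (k%:~R * t) else cos (k%:~R * t)).

Lemma fourier_coef_pos t n :
  fourier_coef t n.+1%:Z = alpha n.+1%:Z * sin (n.+1%:R * t).
Proof. by []. Qed.

Lemma fourier_coef_neg t n :
  fourier_coef t (- n.+1%:Z) = alpha (- n.+1%:Z) * cos (n.+1%:R * t).
Proof.
rewrite -NegzE; congr (_ * _).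
by rewrite /= NegzE mulrNz mulNr cosN.
Qed.

Lemma frequencies_bound n k : k \in frequencies n -> `|k| <= n%:Z.
Proof.
elim: n => [|n IH]; first by rewrite inE => /eqP ->.
rewrite mem_cat !inE => /orP[/IH H|/orP[] /eqP ->].
- by apply: le_trans H _; rewrite lez_nat.
- by rewrite ger0_norm.
- by rewrite normrN ger0_norm.
Qed.

Lemma frequencies_uniq n : uniq (frequencies n).
Proof.
elim: n => //= n IH; rewrite cat_uniq IH/=.
rewrite orbF negb_or -andbA; apply/and3P; split.
- by apply/negP => /frequencies_bound; rewrite ger0_norm// lez_nat ltnn.
- by apply/negP => /frequencies_bound; rewrite normrN ger0_norm// lez_nat ltnn.
- by [].
Qed.

Lemma fourier_partial_sumE n t w : fourier_partial_sum alpha Y n t w =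
  \sum_(k <- frequencies n) fourier_coef t k * Y k w.
Proof.
elim: n => [|n IH].
  by rewrite /fourier_partial_sum big_nil addr0 big_seq1 /fourier_coef eqxx; ring.
rewrite frequenciesS big_cat -IH /fourier_partial_sum big_nat_recr// big_cons big_seq1.
rewrite addrA.
rewrite fourier_coef_pos fourier_coef_neg; congr (_ + _).
by rewrite /=; ring.
Qed.

Lemma fourier_partial_sum_Lfun2 n t : fourier_partial_sum alpha Y n t \in Lfun P 2%:E.
Proof.
have -> : fourier_partial_sum alpha Y n t =
    fun w => \sum_(k <- frequencies n) fourier_coef t k * Y k w.
  by apply/funext => w; exact: fourier_partial_sumE.
exact: (Lfun2_sum _ _ orthonormal_Lfun2).
Qed.

Lemma expectation_partial_sums n s t :
  ('E_P[(fourier_partial_sum alpha Y n s \* fourier_partial_sum alpha Y n t)%R] =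
   (\sum_(k <- frequencies n) fourier_coef s k * fourier_coef t k)%:E)%E.
Proof.
pose S t := fourier_partial_sum alpha Y n t.
have SE t' : S t' = fun w => \sum_(k <- frequencies n) fourier_coef t' k * Y k w.
  by apply/funext => w; exact: fourier_partial_sumE.
have Y_S k : ('E_P[(Y k \* S t)%R] =
    (\sum_(l <- frequencies n) fourier_coef t l * (k == l)%:R)%:E)%E.
  have -> : Y k \* S t =
      fun w => \sum_(l <- frequencies n) fourier_coef t l * (Y k \* Y l) w.
    by rewrite SE; apply/funext => w/=; rewrite mulr_sumr; apply: eq_bigr => l _; ring.
  apply: expectation_lincomb => l; last exact: Y_orthonormal.
  by apply: Lfun2_mul_Lfun1; exact: orthonormal_Lfun2.
rewrite -/(S s) -/(S t).
have -> : S s \* S t =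
    fun w => \sum_(k <- frequencies n) fourier_coef s k * (Y k \* S t) w.
  by rewrite [in LHS]SE; apply/funext => w/=; rewrite mulr_suml; apply: eq_bigr => k _; ring.
rewrite (expectation_lincomb _ _ _ Y_S); last first.
  move=> k; apply: Lfun2_mul_Lfun1; first exact: orthonormal_Lfun2.
  exact: fourier_partial_sum_Lfun2.
congr (_%:E); apply: eq_big_seq => k kn; congr (_ * _).
rewrite (bigD1_seq k)//= ?frequencies_uniq// eqxx mulr1 big1 ?addr0// => l lk.
by rewrite eq_sym (negbTE lk) mulr0.
Qed.

Lemma cvg_fourier_covariance s t : 0 <= s <= 2 * pi -> 0 <= t <= 2 * pi ->
  \sum_(k <- frequencies n) fourier_coef s k * fourier_coef t k @[n --> \oo] -->
    fourier_covariance Psi s t.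
Proof.
move=> s02 t02.
have L2 x : 0 <= x <= 2 * pi -> (Psi x : T -> R) \in Lfun P 2%:E.
  move=> x02; apply: (@Lfun2_limit _ _ _ _ (fun n => fourier_partial_sum alpha Y n x)) => //.
    by move=> n; exact: fourier_partial_sum_Lfun2.
  exact: Psi_series.
have H := cvg_expectationM (fun n => fourier_partial_sum_Lfun2 n s)
  (fun n => fourier_partial_sum_Lfun2 n t) (L2 _ s02) (L2 _ t02)
  (Psi_series s02) (Psi_series t02).
have -> : (fun n => \sum_(k <- frequencies n) fourier_coef s k * fourier_coef t k) =
    (fun n => fine ('E_P[(fourier_partial_sum alpha Y n s \*
                         fourier_partial_sum alpha Y n t)%R])%E).
  by apply/funext => n; rewrite expectation_partial_sums.
exact: H.
Qed.

Let c1 k := alpha k%:Z ^+ 2.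
Let c2 k := alpha (- k%:Z) ^+ 2.

Lemma sum_fourier_coefM n s t :
  \sum_(k <- frequencies n) fourier_coef s k * fourier_coef t k =
  alpha 0 ^+ 2 / 4 +
  (cos_sum c1 n (s - t) - cos_sum c1 n (s + t)
   + cos_sum c2 n (s - t) + cos_sum c2 n (s + t)) / 2.
Proof.
elim: n => [|n IH].
  by rewrite big_seq1 /cos_sum !big_nil /fourier_coef eqxx; field.
rewrite frequenciesS big_cat IH /cos_sum !(big_nat_recr n.+1)// big_cons big_seq1.
rewrite !fourier_coef_pos !fourier_coef_neg /c1 /c2.
rewrite mulrBr mulrDr cosB cosD.
by rewrite /=; field.
Qed.

End covariance.

(** * Mixed variation of the covariance *)

Definition variation_constant (R : realType) (rho M : R) : R :=
  2 `^ rho * ((2 * M) `^ rho + 2 `^ rho * ((8 * M) `^ rho + (2 * M) `^ rho)).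

Lemma ler_norm_half_sum4 (R : realType) (p q r s : R) :
  `|(p - q + r + s) / 2| <= `|p| + `|q| + (`|r| + `|s|).
Proof.
have [a1 a2 a3 a4] := And4 (ler_norm p) (ler_norm q) (ler_norm r) (ler_norm s).
have := And4 (ler_norm (- p)) (ler_norm (- q)) (ler_norm (- r)) (ler_norm (- s)).
rewrite !normrN => -[b1 b2 b3 b4].
by rewrite ler_norml; apply/andP; split; lra.
Qed.

Section covariance_variation.
Variables (R : realType) (rho C1 : R) (F : R -> R -> R) (a : R) (c1 c2 : R^nat).
Hypothesis rho_ge1 : 1 <= rho.
Hypothesis c1_ge0 : forall k, 0 <= c1 k.
Hypothesis c2_ge0 : forall k, 0 <= c2 k.
Hypothesis c1_le : forall k, c1 k * k%:R `^ (1 + rho^-1) <= C1.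
Hypothesis c2_le : forall k, c2 k * k%:R `^ (1 + rho^-1) <= C1.
Hypothesis c1_concave :
  forall k, telescope (telescope (fun n => n%:R ^+ 2 * c1 n)) k <= 0.
Hypothesis c2_concave :
  forall k, telescope (telescope (fun n => n%:R ^+ 2 * c2 n)) k <= 0.
Hypothesis F_E : forall s t, 0 <= s <= 2 * pi -> 0 <= t <= 2 * pi ->
  F s t = a + (cos_series c1 (s - t) - cos_series c1 (s + t)
               + cos_series c2 (s - t) + cos_series c2 (s + t)) / 2.

Let K := variation_constant rho (C1 * (1 + 8 * rho)).

Lemma sum_powR_covariance (x y : R^nat) n m :
    nondecreasing_seq x -> nondecreasing_seq y ->
    0 <= x 0%N -> x n <= 2 * pi -> 0 <= y 0%N -> y m <= 2 * pi ->
  \sum_(j < m) (\sum_(i < n) `|rect_incr F (x i) (x i.+1) (y j) (y j.+1)|) `^ rho <=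
  4 * 2 `^ rho * 2 `^ rho * K * Num.min (x n - x 0%N) (y m - y 0%N).
Proof.
move=> xnd ynd x0 xn y0 ym; set D := Num.min _ _.
pose St c s t := cos_series c (s - t) : R; pose An c s t := cos_series c (s + t) : R.
pose A (G : R -> R -> R) j := \sum_(i < n) `|rect_incr G (x i) (x i.+1) (y j) (y j.+1)|.
have A_ge0 G j : 0 <= A G j by exact: sumr_ge0.
have bound_St c : (forall k, 0 <= c k) -> (forall k, c k * k%:R `^ (1 + rho^-1) <= C1) ->
    (forall k, telescope (telescope (fun n => n%:R ^+ 2 * c n)) k <= 0) ->
    \sum_(j < m) A (St c) j `^ rho <= K * D /\ \sum_(j < m) A (An c) j `^ rho <= K * D.
  move=> c0 cle ccv.
  have cvx := cos_series_convex rho_ge1 c0 cle ccv.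
  have mdl z : 0 <= z -> z <= 2 * pi -> cos_series c 0 - cos_series c z <=
      C1 * (1 + 8 * rho) * z `^ rho^-1.
    by move=> z0 _; exact: (cos_series_modulus0 rho_ge1 c0 cle).
  split; first by apply: (sum_powR_stationary rho_ge1 (cos_seriesN c)
    (cos_series_reflect c) cvx mdl).
  by apply: (sum_powR_antistationary rho_ge1 (cos_seriesN c)
    (cos_series_reflect c) cvx mdl).
have [b1 b1'] := bound_St _ c1_ge0 c1_le c1_concave.
have [b2 b2'] := bound_St _ c2_ge0 c2_le c2_concave.
have in02 (z : R^nat) k i : nondecreasing_seq z -> 0 <= z 0%N -> z k <= 2 * pi ->
    (i <= k)%N -> 0 <= z i <= 2 * pi.
  move=> znd z0 zk ik.
  by rewrite (le_trans z0 (znd _ _ (leq0n i))) (le_trans (znd _ _ ik) zk).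
pose A1 j := A (St c1) j + A (An c1) j; pose A2 j := A (St c2) j + A (An c2) j.
pose A0 j := if (j < m)%N then A F j else 0.
have A_le j : 0 <= A0 j <= A1 j + A2 j.
  rewrite /A0; case: ifPn => jm; last by rewrite lexx /= !addr_ge0.
  rewrite A_ge0 /A1 /A2 /A -!big_split/=; apply: ler_sum => i _.
  have xi := in02 x n i xnd x0 xn (ltnW (ltn_ord i)).
  have xi' := in02 x n i.+1 xnd x0 xn (ltn_ord i).
  have yj := in02 y m j ynd y0 ym (ltnW jm); have yj' := in02 y m j.+1 ynd y0 ym jm.
  have -> : rect_incr F (x i) (x i.+1) (y j) (y j.+1) =
      (rect_incr (St c1) (x i) (x i.+1) (y j) (y j.+1)
       - rect_incr (An c1) (x i) (x i.+1) (y j) (y j.+1)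
       + rect_incr (St c2) (x i) (x i.+1) (y j) (y j.+1)
       + rect_incr (An c2) (x i) (x i.+1) (y j) (y j.+1)) / 2.
    by rewrite /rect_incr !F_E// /St /An; field.
  exact: ler_norm_half_sum4.
have -> : \sum_(j < m) (\sum_(i < n)
    `|rect_incr F (x i) (x i.+1) (y j) (y j.+1)|) `^ rho = \sum_(j < m) A0 j `^ rho.
  by apply: eq_bigr => j _; rewrite /A0 ltn_ord.
have A1_ge0 j : 0 <= A1 j by rewrite addr_ge0.
have A2_ge0 j : 0 <= A2 j by rewrite addr_ge0.
have P0 : 0 <= 2 `^ rho :> R by exact: powR_ge0.
apply: (le_trans (sum_powRD_le rho_ge1 m A1_ge0 A2_ge0 A_le)).
have -> : 4 * 2 `^ rho * 2 `^ rho * K * D =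
    2 `^ rho * (2 `^ rho * (K * D + K * D) + 2 `^ rho * (K * D + K * D)) by ring.
apply: ler_wpM2l => //; apply: lerD.
  apply: (le_trans (@sum_powRD_le _ _ rho_ge1 (A (St c1)) (A (An c1)) A1 m _ _ _)) => //.
    by move=> j; rewrite A1_ge0 lexx.
  by apply: ler_wpM2l => //; exact: lerD.
apply: (le_trans (@sum_powRD_le _ _ rho_ge1 (A (St c2)) (A (An c2)) A2 m _ _ _)) => //.
  by move=> j; rewrite A2_ge0 lexx.
by apply: ler_wpM2l => //; exact: lerD.
Qed.

Lemma mixed_variation_covariance s t u v :
    0 <= s -> s <= t -> t <= 2 * pi -> 0 <= u -> u <= v -> v <= 2 * pi ->
  (mixed_variation 1 rho F s t u v <=
   (((4 * 2 `^ rho * 2 `^ rho * K) `^ rho^-1 + 1)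
    * `|t - s| `^ (2 * rho)^-1 * `|v - u| `^ (2 * rho)^-1)%:E)%E.
Proof.
move=> s0 st t2 u0 uv v2.
have rho0 : 0 < rho by move: rho_ge1; lra.
set K' := 4 * _ * _ * K.
have K'0 : 0 <= K' by rewrite !mulr_ge0 ?addr_ge0 ?mulr_ge0 ?addr_ge0 ?powR_ge0.
pose D := Num.min (t - s) (v - u).
have D0 : 0 <= D by rewrite le_min !subr_ge0 st.
apply: (@le_trans _ _ ((K' * D) `^ rho^-1)%:E).
  apply: mixed_variation_le => // x y n m xnd ynd x0 xn y0 ym.
  by rewrite /D -x0 -xn -y0 -ym; apply: sum_powR_covariance; rewrite ?x0 ?xn ?y0 ?ym.
rewrite lee_fin powRM// !ger0_norm ?subr_ge0// -mulrA.
have rho2 : 0 <= (2 * rho)^-1 by rewrite invr_ge0 mulr_ge0// ltW.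
have -> : D `^ rho^-1 = D `^ (2 * rho)^-1 * D `^ (2 * rho)^-1.
  have e : rho^-1 = (2 * rho)^-1 + (2 * rho)^-1 by field; rewrite gt_eqF.
  rewrite {1}e powRD//; apply/implyP; rewrite -e invr_eq0 => /eqP r0.
  by rewrite r0 ltxx in rho0.
apply: ler_pM; rewrite ?mulr_ge0 ?powR_ge0//; first by rewrite lerDl.
by apply: ler_pM; rewrite ?powR_ge0//; apply: (ge0_ler_powR rho2);
  rewrite ?nnegrE ?subr_ge0// /D ge_min lexx ?orbT.
Qed.

End covariance_variation.

Theorem theorem3p2 (R : realType) (rho C1 : R) (hrho : 1 <= rho) :
  exists2 C : R, 0 < C &
  forall (d : measure_display) (T : measurableType d) (P : probability T R)
    (alpha : int -> R) (Y : int -> {RV P >-> R}) (Psi : R -> {RV P >-> R}),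
    (forall k : int, ('E_P[Y k] = 0)%E) ->
    (forall k l : int, ('E_P[(Y k \* Y l)%R] = (k == l)%:R%:E)%E) ->
    fourier_coef_cond rho (fun k : nat => alpha k%:Z ^+ 2) ->
    fourier_coef_cond rho (fun k : nat => alpha (- k%:Z) ^+ 2) ->
    (ereal_sup [set (alpha k ^+ 2 * `|k|%:~R `^ (1 + rho^-1))%:E | k in [set: int]]
       <= C1%:E)%E ->
    is_random_fourier_series alpha Y Psi ->
    finite_holder_controlled_variation rho 0 (2 * pi) (fourier_covariance Psi) /\
    forall s t u v : R,
      0 <= s -> s <= t -> t <= 2 * pi -> 0 <= u -> u <= v -> v <= 2 * pi ->
      (mixed_variation 1 rho (fourier_covariance Psi) s t u v
         <= (C * `|t - s| `^ (2 * rho)^-1 * `|v - u| `^ (2 * rho)^-1)%:E)%E.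
Proof.
exists ((4 * 2 `^ rho * 2 `^ rho * variation_constant rho (C1 * (1 + 8 * rho)))
          `^ rho^-1 + 1).
  by rewrite ltr_wpDl// powR_ge0.
set C := _ + 1 => d T P alpha Y Psi _ Yorth [cv1 _ _ _] [cv2 _ _ _] supC1 Psi_series.
have coefC1 (k : int) : alpha k ^+ 2 * `|k|%:~R `^ (1 + rho^-1) <= C1.
  by rewrite -lee_fin; apply: le_trans supC1; apply: ereal_sup_ubound; exists k.
pose c1 k := alpha k%:Z ^+ 2; pose c2 k := alpha (- k%:Z) ^+ 2.
have c1_ge0 k : 0 <= c1 k by exact: sqr_ge0.
have c2_ge0 k : 0 <= c2 k by exact: sqr_ge0.
have c1_le k : c1 k * k%:R `^ (1 + rho^-1) <= C1.
  by have := coefC1 k%:Z; rewrite ger0_norm.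
have c2_le k : c2 k * k%:R `^ (1 + rho^-1) <= C1.
  by have := coefC1 (- k%:Z); rewrite normrN ger0_norm.
have covE s t : 0 <= s <= 2 * pi -> 0 <= t <= 2 * pi ->
    fourier_covariance Psi s t = alpha 0 ^+ 2 / 4 +
      (cos_series c1 (s - t) - cos_series c1 (s + t)
       + cos_series c2 (s - t) + cos_series c2 (s + t)) / 2.
  move=> s02 t02.
  have H := cvg_fourier_covariance Yorth Psi_series s02 t02.
  apply: (cvg_unique _ H) => //.
  rewrite (funext (fun n => sum_fourier_coefM alpha n s t)).
  have L1 x := @cos_series_cvg _ _ _ _ hrho c1_ge0 c1_le x.
  have L2 x := @cos_series_cvg _ _ _ _ hrho c2_ge0 c2_le x.
  apply: cvgD; first exact: cvg_cst.
  apply: cvgMl; apply: cvgD; last exact: L2.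
  by apply: cvgD; [apply: cvgB; exact: L1|exact: L2].
have main := mixed_variation_covariance hrho c1_ge0 c2_ge0 c1_le c2_le cv1 cv2 covE.
split=> //; exists C => s t s0 st t2.
apply: (le_trans (main _ _ _ _ s0 st t2 s0 st t2)).
rewrite lee_fin -/C -mulrA -powRD; last first.
  apply/implyP; rewrite -mulr2n mulrn_eq0 /= invr_eq0 mulf_eq0 pnatr_eq0 /= => /eqP r0.
  by move: hrho; rewrite r0; lra.
by have -> : (2 * rho)^-1 + (2 * rho)^-1 = rho^-1 by field; lra.
Qed.
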